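(* For any $\alpha\in(0,\infty)$: (i) The interval $[0,1]$ with its Euclidean metric and any absolutely continuous probability measure with density bounded away from both $0$ and $\infty$ is asymptotically disintegrable with rate $\left(O(n^{-\alpha}),O\left(\sqrt{\frac{\ln n}{n}}\right)\right)$. (ii) The circle in $\mathbb{R}^2$ with normalised geodesic metric and any absolutely continuous probability measure with density bounded away from both $0$ and $\infty$ is asymptotically disintegrable with rate $\left(O(n^{-\alpha}),O\left(\sqrt{\frac{\ln n}{n}}\right)\right)$. (iii) Any finite connected simple graph $(V,E)$ with $|V|\ge 2$ embedded in $\mathbb{R}^2$ with the graph metric described in the context and any absolutely continuous probability measure with density bounded away from both $0$ and $\infty$ is asymptotically disintegrable with rate $\left(O(n^{-\alpha}),O\left(\sqrt{\frac{\ln n}{n}}\right)\right)$. (iv) For any natural number $D\geq2$, the unit cube $[0,1]^D$ with its $\ell^\infty$ metric and any absolutely continuous probability measure with density bounded away from both $0$ and $\infty$ is asymptotically disintegrable with rate $\left(O(n^{-\alpha}),O\left(\left(\frac{\ln n}{n}\right)^{1/(2D)}\right)\right)$.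
   Context: $\mathbb{N}=\{1,2,\dots\}$ and $[n]=\{1,\dots,n\}$. A metric Polish probability space $(\mathfrak{X},d,\mu)$ consists of a Polish space $\mathfrak{X}$, a (not necessarily complete) metric $d$ generating its topology, and a Borel probability measure $\mu$. $B(x,r)=\{y\in\mathfrak{X}: d(x,y)\leq r\}$ is the closed ball. Given $n\in\mathbb{N}$, $\epsilon>0$, $r>0$, $(\mathfrak{X},d,\mu)$ is $(n,\epsilon,r)$-disintegrable if, whenever $X_1,\dots,X_n$ are i.i.d. with distribution $\mu$ on a probability space $(\Psi,\mathcal{F},\mathbb{P})$, with $\mathbb{P}$-probability at least $1-\epsilon$ (i.e. on some event of probability at least $1-\epsilon$) there exists a disintegration of $\mu$ along the random multifunction $x\mapsto\{i\in[n]: x\in B(X_i,r)\}$ with respect to the uniform measure on $[n]$; that is, there exist Borel probability measures $\mu_1,\dots,\mu_n$ on $\mathfrak{X}$ with $\mu_i(B(X_i,r))=1$ for all $i$ and $\mu=\frac1n\sum_{i=1}^n\mu_i$. Given functions $\epsilon,r:\mathbb{N}\rightarrow\mathbb{R}_{\geq0}$ tending to zero as $n\rightarrow\infty$, $(\mathfrak{X},d,\mu)$ is asymptotically disintegrable with rate $(\epsilon,r)$ if for all $n$ sufficiently large it is $(n,\epsilon(n),r(n))$-disintegrable. ''With rate $(O(a_n),O(b_n))$'' means: with some rate $(\epsilon,r)$ with $\epsilon(n)=O(a_n)$ and $r(n)=O(b_n)$. ''Density bounded away from both $0$ and $\infty$'' means the density $f$ satisfies $c\le f(x)\le C$ for all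 $x\in\mathfrak{X}$, for some constants $0<c\le C<\infty$; densities are with respect to the uniform probability measure on the space in question (Lebesgue measure for $[0,1]$ and $[0,1]^D$). In (ii), the geodesic metric is normalised so that the circle has diameter $1$. In (iii), the graph is embedded in $\mathbb{R}^2$ arbitrarily using straight-line edges, without any concern for edge-crossings, giving a space $\mathfrak{X}$. Each embedded edge is regarded as having length $1/|E|$, and $d(x,y)$ is the length of the shortest path from $x$ to $y$ traversing only the embedded edges, where moves from one embedded edge to another are permitted only at embedded vertices (so points of distinct edges that happen to cross in the plane other than at a common vertex are treated as distinct points of $\mathfrak{X}$). The uniform probability on $\mathfrak{X}$ is length measure, giving mass $1/|E|$ to each edge. *)

(* Defs.v *)
From HB Require Import structures.
From mathcomp Require Import all_boot all_order all_algebra.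
From mathcomp Require Import lra.
From mathcomp Require Import all_classical all_reals all_analysis.
Import Order.TTheory GRing.Theory Num.Theory.
Import numFieldNormedType.Exports.

Set Implicit Arguments.
Unset Strict Implicit.
Unset Printing Implicit Defensive.

Local Open Scope classical_set_scope.
Local Open Scope ring_scope.

Definition is_metric (R : realType) (T : Type) (rho : T -> T -> R) : Prop :=
  [/\ forall x y, rho x y = 0 <-> x = y,
      forall x y, rho x y = rho y x
    & forall x y z, rho x z <= rho x y + rho y z].

Definition metrizes (R : realType) (T : topologicalType) (rho : T -> T -> R) :=
  forall (x : T) (A : set T),
    nbhs x A <-> exists2 e : R, 0 < e & [set y | rho x y < e] `<=` A.

Definition complete_metric (R : realType) (T : Type) (rho : T -> T -> R) :=
  forall u : nat -> T,
    (forall e, 0 < e -> exists N, forall i j, (N <= i)%N -> (N <= j)%N ->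
       rho (u i) (u j) < e) ->
    exists l, forall e, 0 < e -> exists N, forall i, (N <= i)%N ->
      rho (u i) l < e.

Definition separable (T : topologicalType) :=
  exists2 S : set T, countable S & dense S.

Definition completely_metrizable (R : realType) (T : topologicalType) :=
  exists rho : T -> T -> R,
    [/\ is_metric rho, metrizes rho & complete_metric rho].

(* Borel sigma-algebras are generated sigma-algebras, which the library only
   equips with a measurable structure over pointed types; a space carrying a
   probability measure is nonempty anyway. *)
HB.structure Definition PMetric (R : realType) := {T of Pointed T & Metric R T}.

(* The metric [mdist] of a Polish metric space need not be complete: only some
   metric generating the same topology has to be. *)
HB.mixin Record isPolish (R : realType) T & Metric R T := {
  polish_separable : separable T ;
  polish_metrizable : completely_metrizable R T }.

#[short(type="polishMetricType")]
HB.structure Definition PolishMetric (R : realType) :=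
  {T of PMetric R T & isPolish R T}.

Notation Borel T := (g_sigma_algebraType (@open T)).

Definition cball (R : realType) (T : metricType R) (x : T) (r : R) : set T :=
  [set y | mdist x y <= r].

Definition mutually_independent d d' (Psi : measurableType d)
    (T : measurableType d') (R : realType) (P : probability Psi R) (n : nat)
    (X : 'I_n -> {mfun Psi >-> T}) : Prop :=
  forall (J : {set 'I_n}) (A : 'I_n -> set T),
    (forall i, i \in J -> measurable (A i)) ->
    P (\bigcap_(i in [set` J]) X i @^-1` A i) =
    (\prod_(i in J) P (X i @^-1` A i))%E.

Definition iid d d' (Psi : measurableType d) (T : measurableType d')
    (R : realType) (P : probability Psi R) (mu : probability T R) (n : nat)
    (X : 'I_n -> {mfun Psi >-> T}) : Prop :=
  (forall i A, measurable A -> distribution P (X i) A = mu A) /\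
  mutually_independent P X.

Section disintegrability.
Context {R : realType} (T : polishMetricType R).
Variable mu : probability (Borel T) R.

(* A disintegration of [mu] along the multifunction
   y |-> {i : y \in cball (x i) r}, w.r.t. the uniform measure on 'I_n. *)
Definition has_disintegration (n : nat) (x : 'I_n -> T) (r : R) : Prop :=
  exists nu : 'I_n -> probability (Borel T) R,
    (forall i, nu i (cball (x i) r) = 1%E) /\
    (forall A, measurable A ->
       mu A = (n%:R^-1%:E * \sum_(i < n) nu i A)%E).

(* The set of outcomes admitting a disintegration need not be an event: it is
   only required to contain an event of probability at least 1 - eps. *)
Definition disintegrable (n : nat) (eps r : R) : Prop :=
  forall d (Psi : measurableType d) (P : probability Psi R)
    (X : 'I_n -> {mfun Psi >-> Borel T}), iid P mu X ->
  exists E : set Psi, [/\ measurable E, ((1 - eps)%:E <= P E)%E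
    & forall w, E w -> has_disintegration (fun i => X i w) r].

Definition asymptotically_disintegrable (eps r : nat -> R) : Prop :=
  [/\ forall n, 0 <= eps n /\ 0 <= r n,
      eps @ \oo --> 0, r @ \oo --> 0
    & \forall n \near \oo, disintegrable n (eps n) (r n)].

Definition asymptotically_disintegrable_O (a b : nat -> R) : Prop :=
  exists eps r : nat -> R,
    [/\ asymptotically_disintegrable eps r, eps =O_\oo a & r =O_\oo b].

End disintegrability.

Definition has_bounded_density d (T : measurableType d) (R : realType)
    (lam mu : probability T R) : Prop :=
  exists f : T -> R,
    [/\ measurable_fun [set: T] f,
        exists c C : R, 0 < c /\ forall x, c <= f x <= C
      & forall A, measurable A -> mu A = (\int[lam]_(x in A) (f x)%:E)%E].

Section compact_polish.
Context {R : realType} (T : PMetric.type R).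
Hypothesis cT : compact [set: T].

Lemma compact_separable : separable T.
Proof.
have [B cB [oB bB]] := @compact_second_countable R T cT.
exists ((fun V : set T => get V) @` B).
  exact: card_le_trans (card_image_le _ _) cB.
move=> O [x Ox] oO.
have [V [BV Vx] VO] := bB x O (open_nbhs_nbhs (conj oO Ox)).
exists (get V); split; last by exists V.
by apply: VO; apply: getPex; exists x.
Qed.

Lemma compact_metrizable : completely_metrizable R T.
Proof.
exists mdist; split.
- split; [|exact: metric_sym|by move=> *; exact: metric_triangle].
  by move=> x y; split=> [/mdist_positivity//|->]; rewrite mdistxx.
- move=> x A; rewrite -nbhs_ballE; split=> -[e e0 eA]; exists e => //.
    by rewrite -ballEmdist.
  by rewrite ballEmdist.
- move=> u uC.
  have [l [_ ul]] := cT (fmap_proper_filter u _) (@filterT _ (u @ \oo) _).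
  exists l => e e0.
  have e20 : 0 < e / 2 by rewrite divr_gt0.
  have [N Nu] := uC _ e20.
  have uN : (u @ \oo) (u @` [set i | (N <= i)%N]).
    by exists N => // i /= Ni; exists i.
  have [_ [[j /= Nj <-]]] := ul _ _ uN (nbhsx_ballx l _ e20).
  rewrite ballEmdist /= => lj; exists N => i Ni.
  rewrite (le_lt_trans (metric_triangle _ (u j) _))// [e]splitr ltrD//.
    exact: Nu.
  by rewrite metric_sym.
Qed.
End compact_polish.

Section maps.
Context {R : realType}.

Lemma lipschitz_cont (S T : metricType R) (f : S -> T) (K : R) :
  (forall x y, mdist (f x) (f y) <= K * mdist x y) -> continuous f.
Proof.
move=> fK x; apply/metricType_numDomainType.cvgrPdist_lt => e e0.
have K0 : 0 < `|K| + 1 by rewrite ltr_wpDl.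
have d0 : 0 < e / (`|K| + 1) by rewrite divr_gt0.
near=> y; rewrite (le_lt_trans (fK _ _))//.
rewrite (@le_lt_trans _ _ ((`|K| + 1) * mdist x y))//.
  by rewrite ler_wpM2r// ?mdist_ge0// (le_trans (ler_norm _))// lerDl.
rewrite -ltr_pdivlMl// mulrC.
by near: y; have := nbhsx_ballx x _ d0; rewrite ballEmdist.
Unshelve. all: by end_near. Qed.

Lemma continuous_Borel (S T : PMetric.type R) (f : S -> T) :
  continuous f -> measurable_fun [set: Borel S] (f : Borel S -> Borel T).
Proof.
move=> /continuousP cf.
apply: (@measurability _ _ (Borel S) (Borel T) setT f (@open T) erefl).
by move=> _ [A oA <-]; rewrite setTI; apply: sub_sigma_algebra; exact: cf.
Qed.

Lemma measurable_of_balls d (S : measurableType d) (T : polishMetricType R)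
    (f : S -> T) :
  (forall x e, 0 < e -> measurable (f @^-1` [set y | mdist x y < e])) ->
  measurable_fun [set: S] (f : S -> Borel T).
Proof.
move=> fb.
apply: (@measurability _ _ S (Borel T) setT f (@open T) erefl).
move=> _ [A oA <-]; rewrite setTI.
have [Q cQ dQ] := @polish_separable R T.
pose I := [set p : T * nat | Q p.1 /\ [set y | mdist p.1 y < p.2.+1%:R^-1] `<=` A].
have cI : countable I.
  apply: (@sub_countable _ _ _ (Q `*` [set: nat])).
    by apply: subset_card_le => p [].
  by apply: countableX.
have -> : A = \bigcup_(p in I) [set y | mdist p.1 y < p.2.+1%:R^-1].
  apply/seteqP; split=> [x Ax|x [p [_ pA]]]; last exact: pA.
  have : nbhs x A by apply: open_nbhs_nbhs.
  rewrite -nbhs_ballE => -[e /= e0]; rewrite ballEmdist => eA.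
  have [n _ ne] : exists2 n : nat, True & n.+1%:R^-1 < e / 2.
    have [|N] := @ltr_add_invr R 0%R (e / 2); first by rewrite divr_gt0.
    by rewrite add0r; exists N.
  have [q [qx Qq]] : ((ball x n.+1%:R^-1)° `&` Q) !=set0.
    apply: dQ; last exact: open_interior.
    by exists x; apply: nbhsx_ballx.
  have {}qx : mdist x q < n.+1%:R^-1.
    by have := interior_subset qx; rewrite ballEmdist.
  exists (q, n) => /=; last by rewrite metric_sym.
  split=> //= y qy; apply: eA => /=.
  rewrite (le_lt_trans (metric_triangle _ q _))// [e]splitr ltrD//.
    exact: lt_trans qx _.
  exact: lt_trans qy _.
have /countable_injP[g ig] := cI.
rewrite preimage_bigcup.
have -> : \bigcup_(p in I) (f @^-1` [set y | mdist p.1 y < p.2.+1%:R^-1]) =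
    \bigcup_n \bigcup_(p in I `&` [set p | g p = n])
      (f @^-1` [set y | mdist p.1 y < p.2.+1%:R^-1]).
  apply/seteqP; split=> [x [p Ip px]|x [n _ [p [Ip _] px]]].
    by exists (g p) => //; exists p.
  by exists p.
apply: bigcupT_measurable => n.
have [[p [Ip gp]]|nI] := pselect (exists p, I p /\ g p = n).
  rewrite (_ : _ `&` _ = [set p]) ?bigcup_set1; first exact: fb.
  apply/seteqP; split=> [q [Iq /= gq]|q ->//].
  by apply: ig; rewrite ?inE// gq gp.
rewrite (_ : _ `&` _ = set0) ?bigcup_set0//.
by apply/seteqP; split=> // q [Iq gq]; apply: nI; exists q.
Qed.
End maps.

Definition image_law d d' (S : measurableType d) (T : measurableType d')
    (R : realType) (P : probability S R) (f : S -> T)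
    (mf : measurable_fun [set: S] f) : probability T R :=
  distribution P (mfun_Sub (mem_set mf)).

Definition unit_interval (R : realType) := {x : R | 0 <= x <= 1}.

Section unit_interval.
Context {R : realType}.
Local Notation I := (unit_interval R).

HB.instance Definition _ := SubChoice.copy I {x : R | 0 <= x <= 1}.

Definition I_dist (x y : I) : R := `|val x - val y|.

Let I_distxx x : I_dist x x = 0.
Proof. by rewrite /I_dist subrr normr0. Qed.

Let I_dist_positivity x y : I_dist x y = 0 -> x = y.
Proof. by move/normr0_eq0/eqP; rewrite subr_eq0 => /eqP/val_inj. Qed.

Let I_dist_sym x y : I_dist x y = I_dist y x.
Proof. exact: distrC. Qed.

Let I_dist_triangle y x z : I_dist x z <= I_dist x y + I_dist y z.
Proof. exact: ler_distD. Qed.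

HB.instance Definition _ :=
  isMetric.Build R I I_distxx I_dist_positivity I_dist_sym I_dist_triangle.

Lemma clamp_subproof (x : R) : 0 <= Num.min (Num.max x 0) 1 <= 1.
Proof. by rewrite le_min le_max lexx orbT ler01 ge_min lexx orbT. Qed.

Definition clamp (x : R) : I := exist (fun y : R => is_true (0 <= y <= 1)) _ (clamp_subproof x).

HB.instance Definition _ := isPointed.Build I (clamp 0).

Lemma val_clamp (x : R) : 0 <= x <= 1 -> val (clamp x) = x.
Proof. by case/andP=> x0 x1 /=; rewrite max_l// min_l. Qed.

Lemma clampK : cancel (val : I -> R) clamp.
Proof. by move=> x; apply/val_inj/val_clamp/(valP x). Qed.

Lemma clamp_lip (x y : R) : `|val (clamp x) - val (clamp y)| <= `|x - y|.
Proof.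
rewrite /= /Order.min /Order.max.
case: (ltP x 0) => x0; case: (ltP y 0) => y0; rewrite ?ltr01;
  case: (ltP x 1) => x1; case: (ltP y 1) => y1;
  rewrite ler_norml; case: (ger0P (x - y)) => xy; lra.
Qed.

Lemma clamp_cont : continuous clamp.
Proof.
move=> x; apply/metricType_numDomainType.cvgrPdist_lt => e e0.
apply: filterS (nbhsx_ballx x e e0) => y xy.
exact: le_lt_trans (clamp_lip x y) xy.
Qed.

Lemma measurable_clamp : measurable_fun [set: R] (clamp : R -> Borel I).
Proof.
apply: (@measurability _ _ _ (Borel I) setT clamp (@open I) erefl).
move=> _ [A oA <-]; rewrite setTI; apply: measurable_realfun.open_measurable.
by move/continuousP : clamp_cont; apply.
Qed.

Lemma I_compact : compact [set: I].
Proof.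
rewrite (_ : setT = clamp @` `[0, 1]).
  apply: continuous_compact; last exact: segment_compact.
  by apply: continuous_subspaceT => x; exact: clamp_cont.
apply/seteqP; split=> // x _; exists (val x); last exact: clampK.
by rewrite /= in_itv/=; exact: (valP x).
Qed.

HB.instance Definition _ :=
  isPolish.Build R I (compact_separable I_compact) (compact_metrizable I_compact).

(* Lebesgue measure of [0, 1], transported from R by [clamp], which is the
   identity on [0, 1]. *)
Definition I_uniform : probability (Borel I) R :=
  image_law (uniform_prob (@ltr01 R)) measurable_clamp.

Lemma compact_image_I (T : metricType R) (f : I -> T) :
  continuous f -> compact (range f).
Proof.
move=> cf; apply: continuous_compact; last exact: I_compact.
exact: continuous_subspaceT.
Qed.
End unit_interval.

Definition circle (R : realType) := {p : R * R | p.1 ^+ 2 + p.2 ^+ 2 == 1}.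

Section circle.
Context {R : realType}.
Local Notation C := (circle R).

HB.instance Definition _ :=
  SubChoice.copy C {p : R * R | p.1 ^+ 2 + p.2 ^+ 2 == 1}.

Definition rotate (t : R) (p : R * R) : R * R :=
  (cos t * p.1 - sin t * p.2, sin t * p.1 + cos t * p.2).

Lemma rotateD s t p : rotate (s + t) p = rotate s (rotate t p).
Proof. by rewrite /rotate sinD cosD/=; congr pair; lra. Qed.

Lemma rotate0 p : rotate 0 p = p.
Proof.
by rewrite /rotate cos0 sin0 !mul1r !mul0r subr0 add0r -surjective_pairing.
Qed.

(* Lengths of the arcs from p to q, divided by pi so that the diameter is 1. *)
Definition arcs (p q : C) : set R :=
  [set l | exists2 t : R, rotate t (val p) = val q & l = `|t| / pi].

Definition C_dist (p q : C) : R := inf (arcs p q).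

Lemma circle_pt_subproof (t : R) : (cos t, sin t).1 ^+ 2 + (cos t, sin t).2 ^+ 2 == 1.
Proof. by rewrite /= cos2Dsin2. Qed.

Definition circle_pt (t : R) : C := exist (fun p : R * R => is_true (p.1 ^+ 2 + p.2 ^+ 2 == 1)) _ (circle_pt_subproof t).

HB.instance Definition _ := isPointed.Build C (circle_pt 0).

Lemma circle_ptP (p : C) : exists2 t, 0 <= t <= 1 & p = circle_pt (2 * pi * t).
Proof.
case: p => -[x y] /= xy1.
have xy : x ^+ 2 + y ^+ 2 = 1 by exact/eqP.
have x1 : -1 <= x <= 1.
  by have y2 := sqr_ge0 y; apply/andP; split; nra.
have ax0 := acos_ge0 x1.
have axpi := acos_lepi x1.
have pi0 : 0 < pi :> R := pi_gt0 R.
have ys : Num.sqrt (1 - x ^+ 2) = `|y| by rewrite -xy addrC addKr sqrtr_sqr.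
have [y0|y0] := leP 0 y.
  exists (acos x / (2 * pi)).
    by rewrite divr_ge0 ?mulr_ge0 ?pi_ge0//= ler_pdivrMr ?mulr_gt0//; lra.
  apply: val_inj => /=; rewrite mulrC divfK ?gt_eqF ?mulr_gt0//.
  by rewrite acosK// sin_acos// ys ger0_norm.
exists ((2 * pi - acos x) / (2 * pi)).
  by rewrite divr_ge0 ?mulr_ge0 ?pi_ge0 ?ler_pdivrMr ?mulr_gt0//=; lra.
apply: val_inj => /=; rewrite mulrC divfK ?gt_eqF ?mulr_gt0//.
rewrite addrC mulr_natl cosD2pi sinD2pi cosN sinN acosK// sin_acos// ys.
by rewrite ltr0_norm// opprK.
Qed.

Lemma arcs_pt (s t : R) : arcs (circle_pt s) (circle_pt t) (`|s - t| / pi).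
Proof.
exists (t - s); last by rewrite distrC.
have -> : val (circle_pt t) = (cos (t - s + s), sin (t - s + s)) by rewrite subrK.
by rewrite /rotate/= (cosD (t - s)) (sinD (t - s)); congr pair; lra.
Qed.

Lemma arcs_neq0 p q : arcs p q !=set0.
Proof.
have [s _ ->] := circle_ptP p; have [t _ ->] := circle_ptP q.
by exists (`|2 * pi * s - 2 * pi * t| / pi); exact: arcs_pt.
Qed.

Lemma arcs_ge0 p q : lbound (arcs p q) 0.
Proof. by move=> _ [t _ ->]; rewrite divr_ge0// pi_ge0. Qed.

Lemma C_dist_le p q l : arcs p q l -> C_dist p q <= l.
Proof. by move=> pql; apply: ge_inf => //; exists 0; exact: arcs_ge0. Qed.

Let C_dist_ge0 p q : 0 <= C_dist p q.
Proof. by apply: lb_le_inf; [exact: arcs_neq0|exact: arcs_ge0]. Qed.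

Let C_distxx p : C_dist p p = 0.
Proof.
apply/eqP; rewrite eq_le C_dist_ge0 andbT; apply: C_dist_le.
by exists 0; rewrite ?rotate0// normr0 mul0r.
Qed.

Let C_dist_sym p q : C_dist p q = C_dist q p.
Proof.
congr inf; apply/seteqP; split=> _ [t tpq ->]; exists (- t); rewrite ?normrN//.
  by rewrite -tpq -rotateD addNr rotate0.
by rewrite -tpq -rotateD addNr rotate0.
Qed.

Let C_dist_triangle q p r : C_dist p r <= C_dist p q + C_dist q r.
Proof.
apply/ler_addgt0Pl => e e0.
have e2 : 0 < e / 2 by rewrite divr_gt0.
have [|_ [s spq ->] sl] := @inf_lt _ (arcs p q) (C_dist p q + e / 2) (arcs_neq0 p q).
  by rewrite ltrDl.
have [|_ [t tqr ->] tl] := @inf_lt _ (arcs q r) (C_dist q r + e / 2) (arcs_neq0 q r).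
  by rewrite ltrDl.
apply: (@le_trans _ _ (`|t + s| / pi)).
  by apply: C_dist_le; exists (t + s) => //; rewrite rotateD spq.
apply: (@le_trans _ _ (`|t| / pi + `|s| / pi)).
  by rewrite -mulrDl ler_wpM2r ?invr_ge0 ?pi_ge0// ler_normD.
lra.
Qed.

Let cvg0_eq (g : R -> R) (a b : R) : g t @[t --> (0 : R)] --> a ->
  (forall e, 0 < e -> exists2 t, `|t| < e & g t = b) -> a = b.
Proof.
move=> /cvgrPdist_lt ga gb; apply: contrapT => /eqP ab.
have ab0 : 0 < `|a - b| by rewrite normr_gt0 subr_eq0.
have := ga _ ab0; rewrite -nbhs_ballE => -[e /= e0 eb].
have [t te gtb] := gb _ e0.
by have := eb t; rewrite /ball/= sub0r normrN gtb ltxx => /(_ te).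
Qed.

Let C_dist_positivity p q : C_dist p q = 0 -> p = q.
Proof.
move=> pq0; have pi0 : 0 < pi :> R := pi_gt0 R.
have h e : 0 < e -> exists2 t : R, `|t| < e & rotate t (val p) = val q.
  move=> e0.
  have [|_ [t tpq ->] tl] := @inf_lt _ (arcs p q) (e / pi) (arcs_neq0 p q).
    by rewrite -/(C_dist p q) pq0 divr_gt0.
  by exists t => //; rewrite -(ltr_pM2r (x := pi^-1)) ?invr_gt0.
have r0 := rotate0 (val p).
apply: val_inj; rewrite (surjective_pairing (val p)) (surjective_pairing (val q)).
congr pair.
- apply: (@cvg0_eq (fun t => (rotate t (val p)).1)).
    rewrite -[X in _ --> X.1]r0 /=.
    by apply: cvgB; apply: cvgMl; [exact: continuous_cos|exact: continuous_sin].
  by move=> e /h[t te tpq]; exists t; rewrite ?tpq.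
- apply: (@cvg0_eq (fun t => (rotate t (val p)).2)).
    rewrite -[X in _ --> X.2]r0 /=.
    by apply: cvgD; apply: cvgMl; [exact: continuous_sin|exact: continuous_cos].
  by move=> e /h[t te tpq]; exists t; rewrite ?tpq.
Qed.

HB.instance Definition _ :=
  isMetric.Build R C C_distxx C_dist_positivity C_dist_sym C_dist_triangle.

Definition circle_of_I (t : unit_interval R) : C := circle_pt (2 * pi * val t).

Lemma circle_of_I_cont : continuous circle_of_I.
Proof.
apply: (@lipschitz_cont R _ _ _ 2) => s t.
rewrite (le_trans (C_dist_le (arcs_pt _ _)))//.
rewrite -mulrBr normrM ger0_norm ?mulr_ge0 ?pi_ge0//.
by rewrite mulrAC mulfK// gt_eqF// pi_gt0.
Qed.

Lemma circle_compact : compact [set: C].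
Proof.
rewrite (_ : setT = range circle_of_I).
  exact: compact_image_I circle_of_I_cont.
apply/seteqP; split=> // p _; have [t t01 ->] := circle_ptP p.
by exists (clamp t) => //; rewrite /circle_of_I val_clamp.
Qed.

HB.instance Definition _ := isPolish.Build R C
  (compact_separable circle_compact) (compact_metrizable circle_compact).

Definition circle_uniform : probability (Borel C) R :=
  image_law I_uniform (continuous_Borel circle_of_I_cont).
End circle.

Record embedded_graph (R : realType) := EmbeddedGraph {
  vertex :> finType ;
  adj : rel vertex ;
  adj_sym : symmetric adj ;
  adj_irr : irreflexive adj ;
  adj_connected : forall u v, connect adj u v ;
  vertex_card : (2 <= #|vertex|)%N ;
  position : vertex -> 'rV[R]_2 ;
  position_inj : injective position }.

Definition edges (R : realType) (G : embedded_graph R) : {set {set G}} :=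
  [set [set uv.1; uv.2]%SET | uv : G * G & adj uv.1 uv.2].

Definition oriented_edge (R : realType) (G : embedded_graph R) :=
  {uv : G * G | adj uv.1 uv.2}.

(* A point of the drawing is stored as a pair (b, z) where z is its place in the
   plane and b gives its barycentric coordinates: the point (1 - t) u + t v of
   the straight edge uv has b u = 1 - t, b v = t and b w = 0 for the other vertices w.
   Thus points of distinct edges that happen to share the same place z without
   being a common vertex are distinct points of the space. *)
Definition on_edge (R : realType) (G : embedded_graph R) (b : {ffun G -> R})
    (u v : G) : bool :=
  adj u v && [forall w, (w != u) && (w != v) ==> (b w == 0)].

Definition barycentric (R : realType) (G : embedded_graph R)
    (b : {ffun G -> R}) : bool :=
  [&& [forall v, 0 <= b v], \sum_v b v == 1
    & [exists u, exists v, on_edge b u v]].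

Definition on_graph (R : realType) (G : embedded_graph R)
    (x : {ffun G -> R} * 'rV[R]_2) : bool :=
  barycentric x.1 && (x.2 == \sum_v x.1 v *: position v).

Definition graph_space (R : realType) (G : embedded_graph R) :=
  {x : {ffun G -> R} * 'rV[R]_2 | on_graph x}.

Section mixture.
Local Open Scope ereal_scope.
Context d (T : measurableType d) (R : realType) (I : finType).
Variables (P : I -> probability T R).

Definition mixture of (0 < #|I|)%N : set T -> \bar R :=
  fun A => #|I|%:R^-1%:E * \sum_i P i A.

Variable I0 : (0 < #|I|)%N.

Let mixture0 : mixture I0 set0 = 0.
Proof. by rewrite /mixture big1 ?mule0. Qed.

Let mixture_ge0 A : 0 <= mixture I0 A.
Proof. by rewrite mule_ge0 ?lee_fin ?invr_ge0 ?sume_ge0. Qed.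

Let mixture_sigma_additive : semi_sigma_additive (mixture I0).
Proof.
move=> F mF tF mUF; rewrite [X in X @ \oo --> _](_ : _ =
    (fun n => #|I|%:R^-1%:E * \sum_i \sum_(0 <= k < n) P i (F k))); last first.
  apply/funext => n; rewrite exchange_big/= ge0_sume_distrr// => k _.
  exact: sume_ge0.
apply: cvgeZl => //; apply: cvg_nnesum => [i _|i _].
  by near=> n; exact: sume_ge0.
exact: measure_semi_sigma_additive.
Unshelve. all: by end_near. Qed.

HB.instance Definition _ := isMeasure.Build _ _ _ (mixture I0)
  mixture0 mixture_ge0 mixture_sigma_additive.

Let mixture_setT : mixture I0 [set: T] = 1.
Proof.
rewrite /mixture (eq_bigr (fun=> 1)) => [|i _]; last exact: probability_setT.
rewrite sumEFin sumr_const -EFinM mulVf//.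
by rewrite pnatr_eq0 -lt0n.
Qed.

HB.instance Definition _ := Measure_isProbability.Build _ _ _
  (mixture I0) mixture_setT.
End mixture.

Section graph_space.
Context {R : realType} (G : embedded_graph R).
Local Notation X := (graph_space G).

HB.instance Definition _ :=
  SubChoice.copy X {x : {ffun G -> R} * 'rV[R]_2 | on_graph x}.

Definition bary (x : X) : {ffun G -> R} := (val x).1.

(* Paths are concatenations of pieces, each inside one edge uv and of length
   1/|E| times the fraction of uv travelled. A point lying on two distinct edges
   is a common vertex, so a path changes edges only at vertices. *)
Inductive path_of_length : X -> X -> R -> Prop :=
| path_nil x : path_of_length x x 0
| path_cons x y z u v l :
    on_edge (bary x) u v -> on_edge (bary y) u v -> path_of_length y z l ->
    path_of_length x z (`|bary x u - bary y u| / #|edges G|%:R + l).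

Definition graph_dist (x y : X) : R := inf [set l | path_of_length x y l].

Lemma bary_inj : injective bary.
Proof.
move=> [[b p] bp] [[c q] cq] /= bc; apply: val_inj => /=.
rewrite /bary/= in bc; move: bp cq; rewrite /on_graph/= bc.
by move=> /andP[_ /eqP->] /andP[_ /eqP->].
Qed.

Lemma bary_ge0 x v : 0 <= bary x v.
Proof. by have /andP[/and3P[/forallP h _ _] _] := valP x; exact: h. Qed.

Lemma bary_sum x : \sum_v bary x v = 1.
Proof. by have /andP[/and3P[_ /eqP h _] _] := valP x. Qed.

Lemma bary_edge x : exists u v, on_edge (bary x) u v.
Proof.
by have /andP[/and3P[_ _ /existsP[u /existsP[v h]]] _] := valP x; exists u, v.
Qed.

Lemma on_edge_neq (b : {ffun G -> R}) u v : on_edge b u v -> u != v.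
Proof.
by move=> /andP[uv _]; apply: contraTneq uv => ->; rewrite adj_irr.
Qed.

Lemma on_edge0 (b : {ffun G -> R}) u v w :
  on_edge b u v -> w != u -> w != v -> b w = 0.
Proof.
by move=> /andP[_ /forallP/(_ w)/implyP h] wu wv; apply/eqP/h; rewrite wu.
Qed.

Lemma on_edgeC (b : {ffun G -> R}) u v : on_edge b u v -> on_edge b v u.
Proof.
move=> /andP[uv /forallP h]; rewrite /on_edge adj_sym uv/=; apply/forallP => w.
by rewrite andbC.
Qed.

Lemma on_edge_sum x u v : on_edge (bary x) u v -> bary x u + bary x v = 1.
Proof.
move=> xuv; rewrite -(bary_sum x) (bigD1 u)//= (bigD1 v)/=; last first.
  by rewrite eq_sym (on_edge_neq xuv).
rewrite big1 ?addr0// => w /andP[wu wv]; exact: on_edge0 xuv wu wv.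
Qed.

Lemma neighbour (u : G) : exists v, adj u v.
Proof.
have /card_gt1P[a [b [_ _ ab]]] := @vertex_card R G.
have [w wu] : exists w, w != u.
  have [au|] := eqVneq a u; last by exists a.
  by exists b; rewrite eq_sym -au.
have /connectP[[|v p] /= uvp wE] := adj_connected u w.
  by rewrite wE eqxx in wu.
by exists v; case/andP: uvp.
Qed.

Lemma edges_gt0 : (0 < #|edges G|)%N.
Proof.
have /card_gt1P[u [_ [_ _ _]]] := @vertex_card R G.
have [v uv] := neighbour u.
by apply/card_gt0P; exists [set u; v]%SET; apply/imsetP; exists (u, v); rewrite ?inE.
Qed.

Lemma point_of_bary_subproof (b : {ffun G -> R}) : barycentric b ->
  on_graph (b, \sum_v b v *: position v).
Proof. by move=> hb; rewrite /on_graph/= hb eqxx. Qed.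

Definition point_of_bary (b : {ffun G -> R}) (hb : barycentric b) : X :=
  exist (fun x : {ffun G -> R} * 'rV[R]_2 => is_true (on_graph x)) _
    (point_of_bary_subproof hb).

Definition edge_coord (u v : G) (t : R) : {ffun G -> R} :=
  [ffun w => (1 - t) *+ (w == u) + t *+ (w == v)].

Lemma edge_coord_on u v t : adj u v -> on_edge (edge_coord u v t) u v.
Proof.
move=> uv; rewrite /on_edge uv/=; apply/forallP => w; apply/implyP.
by rewrite ffunE => /andP[/negPf-> /negPf->]; rewrite addr0.
Qed.

Lemma edge_coord_barycentric (uv : oriented_edge G)
  (t : unit_interval R) : barycentric (edge_coord (val uv).1 (val uv).2 (val t)).
Proof.
case: uv t => -[u v] /= uv [t /= /andP[t0 t1]]; apply/and3P; split.
- apply/forallP => w; rewrite ffunE addr_ge0// mulrn_wge0//.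
  by rewrite subr_ge0.
- under eq_bigr do rewrite ffunE.
  have sE (c : R) (a : G) : \sum_w c *+ (w == a) = c.
    by rewrite (bigD1 a)//= eqxx big1 ?addr0// => w /negPf->.
  by rewrite big_split/= !sE subrK.
- by apply/existsP; exists u; apply/existsP; exists v; exact: edge_coord_on.
Qed.

Definition edge_point (uv : oriented_edge G)
  (t : unit_interval R) : X := point_of_bary (edge_coord_barycentric uv t).

Lemma edge_pointP x u v (xuv : on_edge (bary x) u v) (uv : adj u v) :
  exists t, x = edge_point (exist _ (u, v) uv) t.
Proof.
have x01 : 0 <= bary x v <= 1.
  by rewrite bary_ge0 -(on_edge_sum xuv) lerDr bary_ge0.
exists (exist (fun r : R => is_true (0 <= r <= 1)) _ x01); apply: bary_inj.
apply/ffunP => w; rewrite ffunE/=.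
have nuv := on_edge_neq xuv.
have [->|wu] := eqVneq w u.
  by rewrite (negPf nuv) addr0 -(on_edge_sum xuv) addrK.
have [->|wv] := eqVneq w v; first by rewrite add0r.
by rewrite addr0 (on_edge0 xuv).
Qed.

Lemma path_ge0 x y l : path_of_length x y l -> 0 <= l.
Proof. by elim=> // *; rewrite addr_ge0// divr_ge0. Qed.

Lemma path_cat x y z k l :
  path_of_length x y k -> path_of_length y z l -> path_of_length x z (k + l).
Proof.
move=> xy; elim: xy l => [a l|a b c u v m au bu _ ih l cz]; first by rewrite add0r.
by rewrite -addrA; apply: path_cons au bu _; exact: ih.
Qed.

Lemma path_one x y u v : on_edge (bary x) u v -> on_edge (bary y) u v ->
  path_of_length x y (`|bary x u - bary y u| / #|edges G|%:R).
Proof. by move=> xu yu; rewrite -[X in path_of_length _ _ X]addr0; apply: path_cons xu yu (path_nil _). Qed.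

Lemma path_sym x y l : path_of_length x y l -> path_of_length y x l.
Proof.
elim=> [a|a b c u v m au bu _ ih]; first exact: path_nil.
rewrite addrC; apply: path_cat ih _; rewrite distrC; exact: path_one bu au.
Qed.

Lemma path_lower x y l w : path_of_length x y l ->
  `|bary x w - bary y w| <= #|edges G|%:R * l.
Proof.
have E0 : 0 < #|edges G|%:R :> R by rewrite ltr0n edges_gt0.
elim=> [a|a b c u v m au bu _ ih]; first by rewrite subrr normr0 mulr0.
rewrite (le_trans (ler_distD (bary b w) _ _))// mulrDr lerD//.
rewrite mulrC divfK ?gt_eqF//.
have [->//|wu] := eqVneq w u.
have [->|wv] := eqVneq w v.
  have := on_edge_sum au; have := on_edge_sum bu => h1 h2.
  rewrite (_ : bary a v - bary b v = - (bary a u - bary b u)) ?normrN//; lra.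
by rewrite (on_edge0 au)// (on_edge0 bu)// subrr normr0.
Qed.

Lemma vertex_ok (u : G) : barycentric [ffun w => (w == u)%:R : R].
Proof.
have [v uv] := neighbour u; apply/and3P; split.
- by apply/forallP => w; rewrite ffunE ler0n.
- by under eq_bigr do rewrite ffunE; rewrite (bigD1 u)//= eqxx big1 ?addr0// => w /negPf->.
- apply/existsP; exists u; apply/existsP; exists v; rewrite /on_edge uv/=.
  by apply/forallP => w; apply/implyP => /andP[/negPf wu _]; rewrite ffunE wu.
Qed.

Definition vertex_point (u : G) : X := point_of_bary (vertex_ok u).

Lemma vertex_on u v : adj u v -> on_edge (bary (vertex_point u)) u v.
Proof.
move=> uv; rewrite /on_edge uv/=; apply/forallP => w; apply/implyP.
by move=> /andP[/negPf wu _]; rewrite ffunE wu.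
Qed.

Lemma path_vertex u v : exists l, path_of_length (vertex_point u) (vertex_point v) l.
Proof.
have /connectP[p] := adj_connected u v.
elim: p u => [|w p ih] u /=; first by move=> _ ->; exists 0; exact: path_nil.
move=> /andP[uw wp] /(ih _ wp)[l wl].
exists (`|bary (vertex_point u) u - bary (vertex_point w) u| / #|edges G|%:R + l).
apply: path_cons wl; first exact: vertex_on uw.
by apply: on_edgeC; apply: vertex_on; rewrite adj_sym.
Qed.

Lemma path_exists x y : exists l, path_of_length x y l.
Proof.
have [u [u' xu]] := bary_edge x; have [v [v' yv]] := bary_edge y.
have [l uvl] := path_vertex u v.
have uu' : adj u u' by case/andP: xu.
have vv' : adj v v' by case/andP: yv.
have h1 := path_one xu (vertex_on uu').
have h2 := path_one (vertex_on vv') yv.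
by eexists; apply: path_cat h1 (path_cat uvl h2).
Qed.

Lemma graph_dist_le x y l : path_of_length x y l -> graph_dist x y <= l.
Proof.
by move=> xyl; apply: ge_inf => //; exists 0 => k /path_ge0.
Qed.

Let graph_dist_ge0 x y : 0 <= graph_dist x y.
Proof. by apply: lb_le_inf; [exact: path_exists|move=> k /path_ge0]. Qed.

Let graph_distxx x : graph_dist x x = 0.
Proof.
apply/eqP; rewrite eq_le graph_dist_ge0 andbT; apply: graph_dist_le.
exact: path_nil.
Qed.

Let graph_dist_positivity x y : graph_dist x y = 0 -> x = y.
Proof.
move=> xy0; apply: bary_inj; apply/ffunP => w; apply/eqP; rewrite -subr_eq0.
rewrite -normr_le0.
have E0 : 0 < #|edges G|%:R :> R by rewrite ltr0n edges_gt0.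
rewrite -(pmulr_rle0 _ (x := #|edges G|%:R^-1)) ?invr_gt0// -xy0.
apply: lb_le_inf; first exact: path_exists.
by move=> l /(path_lower w) h; rewrite ler_pdivrMl.
Qed.

Let graph_dist_sym x y : graph_dist x y = graph_dist y x.
Proof. by congr inf; apply/seteqP; split=> l /path_sym. Qed.

Let graph_dist_triangle y x z : graph_dist x z <= graph_dist x y + graph_dist y z.
Proof.
apply/ler_addgt0Pl => e e0.
have e2 : 0 < e / 2 by rewrite divr_gt0.
have [|s xys sl] := @inf_lt _ [set l | path_of_length x y l] (graph_dist x y + e / 2) (path_exists _ _).
  by rewrite ltrDl.
have [|t yzt tl] := @inf_lt _ [set l | path_of_length y z l] (graph_dist y z + e / 2) (path_exists _ _).
  by rewrite ltrDl.
rewrite (le_trans (graph_dist_le (path_cat xys yzt)))//.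
lra.
Qed.

HB.instance Definition _ := isMetric.Build R X
  graph_distxx graph_dist_positivity graph_dist_sym graph_dist_triangle.

Lemma graph_inhabited : exists x : X, True.
Proof.
by have /card_gt1P[u _] := @vertex_card R G; exists (vertex_point u).
Qed.

HB.instance Definition _ := isPointed.Build X (projT1 (cid graph_inhabited)).

Lemma edge_point_cont uv : continuous (edge_point uv).
Proof.
apply: (@lipschitz_cont R _ _ _ #|edges G|%:R^-1) => s t.
case: uv => -[u v] uv.
rewrite (le_trans (graph_dist_le (@path_one _ _ u v _ _)))//; try exact: edge_coord_on.
rewrite mulrC ler_wpM2l ?invr_ge0//.
have nuv : u != v by apply: contraTneq uv => /= ->; rewrite adj_irr.
rewrite /bary/= !ffunE eqxx (negPf nuv) !addr0 !mulr1n.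
have -> : 1 - val s - (1 - val t) = - (val s - val t) by lra.
by rewrite normrN.
Qed.

Lemma graph_compact : compact [set: X].
Proof.
rewrite (_ : setT = \big[setU/set0]_(uv : oriented_edge G) range (edge_point uv)).
  apply: bigsetU_compact => uv _.
  exact: compact_image_I (@edge_point_cont uv).
apply/seteqP; split=> // x _; have [u [v xuv]] := bary_edge x.
have uv : adj u v by case/andP: xuv.
have [t ->] := edge_pointP xuv uv.
rewrite -bigcup_seq; exists (exist _ (u, v) uv); last by exists t.
exact: mem_index_enum.
Qed.

HB.instance Definition _ := isPolish.Build R X
  (compact_separable graph_compact) (compact_metrizable graph_compact).


Lemma oriented_edge_gt0 : (0 < #|{: oriented_edge G}|)%N.
Proof.
have /card_gt1P[u _] := @vertex_card R G.
have [v uv] := neighbour u.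
by apply/card_gt0P; exists (exist _ (u, v) uv).
Qed.

Lemma card_oriented_edge : #|{: oriented_edge G}| = (2 * #|edges G|)%N.
Proof.
rewrite card_sig.
pose f (uv : G * G) : {set G} := [set uv.1; uv.2]%SET.
pose A := [set uv : G * G | adj uv.1 uv.2]%SET.
have -> : #|[pred uv : G * G | adj uv.1 uv.2]| = #|A|.
  by apply: eq_card => uv; rewrite !inE.
have EA : edges G = (f @: A)%SET.
  by apply/setP => e; apply/imsetP/imsetP => -[uv h ->]; exists uv => //; move: h; rewrite !inE.
rewrite -sum1_card (partition_big_imset f)/= -EA mulnC -sum_nat_const.
apply: eq_bigr => e; rewrite EA => /imsetP[[u v]]; rewrite inE/= => uv ->.
have nuv : u != v by apply: contraTneq uv => /= ->; rewrite adj_irr.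
rewrite sum1_card (_ : 2%N = #|[set (u, v); (v, u)]%SET|); last first.
  by rewrite cards2 xpair_eqE negb_and nuv.
apply: eq_card => -[a b]; rewrite !inE/= !xpair_eqE -topredE/= !inE/=.
apply/idP/idP.
  move=> /andP[ab /eqP/setP fE].
  have nab : a != b by apply: contraTneq ab => /= ->; rewrite adj_irr.
  have au : (a == u) || (a == v) by have := fE a; rewrite !inE eqxx.
  have bu : (b == u) || (b == v) by have := fE b; rewrite !inE eqxx orbT.
  by move: nab; case/orP: au => /eqP->; case/orP: bu => /eqP->;
    rewrite !eqxx ?orbT.
move=> /orP[] /andP[/eqP-> /eqP->]; first by rewrite uv eqxx.
by rewrite adj_sym uv/=; apply/eqP; rewrite /f/= finset.setUC.
Qed.

(* Every edge is counted once in each of its two orientations, so that it gets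
   mass 2 / #|oriented_edge G| = 1 / #|edges G|. *)
Definition graph_uniform : probability (Borel X) R :=
  mixture (fun uv => image_law I_uniform (continuous_Borel (@edge_point_cont uv)))
    oriented_edge_gt0.
End graph_space.

Definition cube (R : realType) (D : nat) :=
  {x : 'rV[R]_D | [forall i, 0 <= x 0 i <= 1]}.

Section cube.
Context {R : realType} (D : nat).
Local Notation Q := (cube R D).

HB.instance Definition _ :=
  SubChoice.copy Q {x : 'rV[R]_D | [forall i, 0 <= x 0 i <= 1]}.

Definition cube_dist (x y : Q) : R := \big[Num.max/0]_i `|val x 0 i - val y 0 i|.

Let cube_dist_ge0 x y : 0 <= cube_dist x y.
Proof. exact: bigmax_ge_id. Qed.

Let cube_distxx x : cube_dist x x = 0.
Proof.
by apply/eqP; rewrite eq_le cube_dist_ge0 andbT; apply/bigmax_leP; split=> // i _;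
  rewrite subrr normr0.
Qed.

Let cube_dist_positivity x y : cube_dist x y = 0 -> x = y.
Proof.
move=> xy0; apply/val_inj/rowP => i; apply/eqP; rewrite -subr_eq0 -normr_le0.
have : `|val x 0 i - val y 0 i| <= cube_dist x y.
  exact: (le_bigmax _ (fun i => `|val x 0 i - val y 0 i|)).
by rewrite xy0.
Qed.

Let cube_dist_sym x y : cube_dist x y = cube_dist y x.
Proof. by apply: eq_bigr => i _; rewrite distrC. Qed.

Let cube_dist_triangle y x z : cube_dist x z <= cube_dist x y + cube_dist y z.
Proof.
apply/bigmax_leP; split=> [|i _]; first by rewrite addr_ge0.
rewrite (le_trans (ler_distD (val y 0 i) _ _))// lerD//.
  exact: (le_bigmax _ (fun i => `|val x 0 i - val y 0 i|)).
exact: (le_bigmax _ (fun i => `|val y 0 i - val z 0 i|)).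
Qed.

HB.instance Definition _ := isMetric.Build R Q
  cube_distxx cube_dist_positivity cube_dist_sym cube_dist_triangle.

Lemma cube_pt_subproof (t : 'I_D -> unit_interval R) :
  [forall i, 0 <= (\row_i val (t i)) 0 i <= 1].
Proof. by apply/forallP => i; rewrite mxE (valP (t i)). Qed.

Definition cube_pt (t : 'I_D -> unit_interval R) : Q :=
  exist (fun x : 'rV[R]_D => is_true [forall i, 0 <= x 0 i <= 1]) _
    (cube_pt_subproof t).

HB.instance Definition _ := isPointed.Build Q (cube_pt (fun=> point)).

Let clamp_row (x : 'rV[R]_D) : Q := cube_pt (fun i => clamp (x 0 i)).

Let clamp_row_cont : continuous clamp_row.
Proof.
move=> x.
apply/(@metricType_numDomainType.cvgrPdist_lt R Q _ _ (nbhs_filter x)) => e e0.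
near=> y.
have xy : ball x e y by near: y; exact: nbhsx_ballx.
apply: bigmax_lt => // i _; rewrite !mxE.
by rewrite (le_lt_trans (clamp_lip _ _))//; exact: (xy.2 0 i).
Unshelve. all: by end_near. Qed.

Lemma cube_compact : compact [set: Q].
Proof.
rewrite (_ : setT = clamp_row @` [set x : 'rV[R]_D | forall i, `[0, 1]%classic (x 0 i)]).
  apply: continuous_compact; first by apply: continuous_subspaceT; exact: clamp_row_cont.
  by apply: (@rV_compact R D (fun=> `[0, 1]%classic)) => i; exact: segment_compact.
apply/seteqP; split=> // x _; exists (val x).
  by move=> i; rewrite /= in_itv/=; have /forallP := valP x; apply.
apply/val_inj/rowP => i; rewrite mxE; apply: val_clamp.
by have /forallP := valP x; apply.
Qed.

HB.instance Definition _ := isPolish.Build R Q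
  (compact_separable cube_compact) (compact_metrizable cube_compact).

Definition cube_of_tuple (t : D.-tuple (Borel (unit_interval R))) : Q :=
  cube_pt (tnth t).

Lemma measurable_cube_of_tuple :
  measurable_fun [set: D.-tuple (Borel (unit_interval R))]
    (cube_of_tuple : _ -> Borel Q).
Proof.
apply: measurable_of_balls => x e e0.
rewrite (_ : _ @^-1` _ = \bigcap_(i in [set: 'I_D])
  ((fun t => tnth t i) @^-1` [set s : unit_interval R | `|val x 0 i - val s| < e])).
  apply: fin_bigcap_measurable => //.
  move=> i _; rewrite -[X in measurable X]setTI.
  apply: measurable_tnth => //.
  apply: sub_sigma_algebra; rewrite openE => s /= xs.
  rewrite /interior -nbhs_ballE; exists (e - `|val x 0 i - val s|).
    by rewrite /= subr_gt0.
  rewrite ballEmdist => r /= sr.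
  rewrite (le_lt_trans (ler_distD (val s) _ _))//.
  by rewrite addrC -ltrBrDr.
apply/seteqP; split=> t /= h.
  move=> i _ /=; apply: le_lt_trans h.
  have -> : val (tnth t i) = val (cube_of_tuple t) 0 i by rewrite mxE.
  exact: (le_bigmax _ (fun i => `|val x 0 i - val (cube_of_tuple t) 0 i|)).
by apply: bigmax_lt => // i _; rewrite mxE; exact: h.
Qed.
End cube.

Section tuple_law.
Context d (T : measurableType d) (R : realType).

Definition cons_tuple n (xt : T * n.-tuple T) : n.+1.-tuple T :=
  [tuple of xt.1 :: xt.2].

Lemma measurable_cons_tuple n :
  measurable_fun [set: T * n.-tuple T] (@cons_tuple n).
Proof. exact: measurable_cons. Qed.

Fixpoint tuple_law (P : probability T R) n : probability (n.-tuple T) R :=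
  match n with
  | 0 => \d_([tuple] : 0.-tuple T)
  | m.+1 => image_law (P \x tuple_law P m)%E (@measurable_cons_tuple m)
  end.
End tuple_law.

Definition cube_uniform (R : realType) (D : nat) : probability (Borel (cube R D)) R :=
  image_law (tuple_law (@I_uniform R) D) (@measurable_cube_of_tuple R D).

(* Main.v *)
Require Import Defs.
From HB Require Import structures.
From mathcomp Require Import all_boot all_order all_algebra.
From mathcomp Require Import all_classical all_reals all_analysis.
From mathcomp Require Import zify ring lra.
Import Order.TTheory GRing.Theory Num.Theory.
Import numFieldNormedType.Exports.

Set Implicit Arguments.
Unset Strict Implicit.
Unset Printing Implicit Defensive.

Local Open Scope classical_set_scope.
Local Open Scope ring_scope.

(** Cut the space into finitely many cells of diameter at most r / 2 and join
two cells when they touch, so that points of joined cells are within r of each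
other.  A disintegration of mu at scale r is then obtained by moving mass, one
step along the joining relation, so that the cell b ends up with the mass
q b = #{i : X_i in b} / n that the sample puts there: each X_i of b receives an
equal share of what b now holds, and all of it comes from within distance r of
X_i ([disintegration_of_plan]).

To move the mass, fix a simple path from a root cell to every cell k and send
the discrepancy q k - p k, where p is mu, along it.  The net flow through the
oriented edge (a, b) is then the sum of q - p over the cells whose path uses
(a, b): a deviation of the empirical measure from mu on one fixed set.  If all
these deviations are at most B and every cell has mass at least 2 * B * Delta,
where Delta bounds the degrees, then each cell can pay all it has to send out of
the mass it had at the start, so that one step suffices ([routed_transport]).

There are at most #|K|^2 edges, and for each the deviation exceeds B with
probability at most 2 exp (- n B^2 / 8) (the Chernoff bound
[hits_deviation]); with B a large multiple of sqrt (ln n / n) this is beaten by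
n^(- alpha).  The mass condition then asks for cells of mass of order
sqrt (ln n / n), that is of diameter of order (ln n / n)^(1 / (2 D)) in
dimension D, which is the announced rate ([grids_rate]).

It remains to exhibit, for every M, about M^D cells of diameter about 1 / M and
mass about M^(- D) with a connected adjacency of bounded degree
([has_grids]).  In the cube these are the boxes of the regular grid, joined by
king moves.  The interval, the circle and the graphs are treated at once, as
spaces covered by finitely many arcs which meet at their ends only
([arcs_has_grids]). *)

(** * A Chernoff bound for independent coin tosses *)

(** As exp (- x) >= 1 - x, exp x is at most 1 / (1 - x), and
(1 - x) (1 + x + 2 x^2) = 1 + x^2 (1 - 2 x). *)
Lemma expR_quadratic (R : realType) (x : R) :
  x <= 1 / 2 -> expR x <= 1 + x + 2 * x ^+ 2.
Proof.
move=> x2; have x1 : 0 < 1 - x by lra.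
apply: (@le_trans _ _ (1 - x)^-1).
  rewrite -[leLHS]invrK lef_pV2 ?posrE ?invr_gt0 ?expR_gt0// -expRN.
  by rewrite (le_trans _ (expR_ge1Dx _)).
rewrite -[leLHS]mul1r ler_pdivrMr//.
have : 0 <= x ^+ 2 * (1 - 2 * x) by rewrite mulr_ge0 ?sqr_ge0//; lra.
nra.
Qed.

Definition coin (R : realType) (p : R) (b : bool) : R := if b then p else 1 - p.

Lemma coin_ge0 (R : realType) (p : R) b : 0 <= p <= 1 -> 0 <= coin p b.
Proof. by rewrite /coin; case: b; lra. Qed.

(** The first order term vanishes as b - p has mean 0, and the variance is at
most 1; the factor 2 in the exponent, instead of the optimal 1 / 8, only affects
constants. *)
Lemma coin_mgf (R : realType) (p t : R) : 0 <= p <= 1 -> 0 <= t <= 1 / 2 ->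
  \sum_b coin p b * expR (t * ((b : nat)%:R - p)) <= expR (2 * t ^+ 2).
Proof.
move=> p01 t01; rewrite big_bool /coin/=.
have h1 : t * (1 - p) <= 1 / 2 by nra.
have h0 : t * (0 - p) <= 1 / 2 by nra.
have {}h1 := expR_quadratic h1; have {}h0 := expR_quadratic h0.
apply: le_trans (expR_ge1Dx _).
have k1 : p * expR (t * (1 - p)) <= p * (1 + t * (1 - p) + 2 * (t * (1 - p)) ^+ 2).
  by rewrite ler_wpM2l//; lra.
have k0 : (1 - p) * expR (t * (0 - p)) <=
    (1 - p) * (1 + t * (0 - p) + 2 * (t * (0 - p)) ^+ 2).
  by rewrite ler_wpM2l//; lra.
apply: (le_trans (lerD k1 k0)).
have -> : p * (1 + t * (1 - p) + 2 * (t * (1 - p)) ^+ 2) +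
    (1 - p) * (1 + t * (0 - p) + 2 * (t * (0 - p)) ^+ 2) =
    1 + 2 * t ^+ 2 * (p * (1 - p)) by ring.
have : p * (1 - p) <= 1 by nra.
have := sqr_ge0 t; nra.
Qed.

(** Exponential Markov inequality: exp (t (sum b - n p - n B)) is at least 1 on
the event and has mean at most exp (2 n t^2 - n t B), which t = B / 4 minimises.
The mean factorises because the sum ranges over all outcomes of independent
tosses. *)
Lemma chernoff_coins (R : realType) (n : nat) (p B : R) :
    0 <= p <= 1 -> 0 < B <= 1 ->
  \sum_(b : {ffun 'I_n -> bool} | n%:R * (p + B) <= \sum_i (b i : nat)%:R)
    \prod_i coin p (b i) <= expR (- (n%:R * B ^+ 2 / 8)).
Proof.
move=> p01 B01; pose t := B / 4.
pose F (b : {ffun 'I_n -> bool}) := \prod_i (coin p (b i) * expR (t * ((b i : nat)%:R - p)))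
  : R.
have FE (b : {ffun 'I_n -> bool}) : F b = \prod_i coin p (b i) *
    expR (t * (\sum_i (b i : nat)%:R - n%:R * p)).
  rewrite /F big_split/= -expR_sum -mulr_sumr big_split/= sumr_const card_ord.
  by rewrite mulNrn mulr_natl.
apply: (@le_trans _ _ (\sum_(b : {ffun 'I_n -> bool}) F b * expR (- (t * (n%:R * B))))).
  rewrite [leLHS]big_mkcond/=; apply: ler_sum => b _.
  have w0 : 0 <= \prod_i coin p (b i) by apply: prodr_ge0 => i _; exact: coin_ge0.
  rewrite FE -mulrA -expRD; case: ifPn => hb.
    rewrite ler_peMr// -[X in X <= _]expR0 ler_expR -mulrBr.
    have t0 : 0 <= t by rewrite /t; lra.
    by rewrite mulr_ge0// -addrA -opprD -mulrDr subr_ge0.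
  by apply: mulr_ge0; rewrite ?expR_ge0.
rewrite -mulr_suml.
have -> : \sum_(b : {ffun 'I_n -> bool}) F b =
    \prod_(i < n) \sum_(b : bool) coin p b * expR (t * ((b : nat)%:R - p)).
  by rewrite bigA_distr_bigA.
apply: (@le_trans _ _ (expR (2 * t ^+ 2) ^+ n * expR (- (t * (n%:R * B))))).
  rewrite ler_wpM2r ?expR_ge0// -[X in _ ^+ X](card_ord n) -prodr_const.
  apply: ler_prod => i _; apply/andP; split.
    by apply: sumr_ge0 => b _; rewrite mulr_ge0 ?expR_ge0// coin_ge0.
  by apply: coin_mgf => //; rewrite /t; lra.
rewrite -expRM_natl -expRD ler_expR /t le_eqVlt; apply/orP; left; apply/eqP.
by field.
Qed.

(** * Empirical frequencies of an independent sample *)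

Lemma measure_le_bigsetU d (T : measurableType d) (R : realType)
    (P : {measure set T -> \bar R}) (I : finType) (Q : pred I) (F : I -> set T) :
    (forall i, measurable (F i)) ->
  (P (\big[setU/set0]_(i | Q i) F i) <= \sum_(i | Q i) P (F i))%E.
Proof.
move=> mF; have [m ?] : measurable (\big[setU/set0]_(i | Q i) F i) /\
    (P (\big[setU/set0]_(i | Q i) F i) <= \sum_(i | Q i) P (F i))%E; last by [].
apply: (big_rec2 (fun A x => measurable A /\ (P A <= x)%E)) => [|i x A _ [mA Ax]].
  by rewrite measure0.
split; first exact: measurableU.
by rewrite (le_trans (measureU2 _ _ _))// leeD2l.
Qed.

Section empirical.
Context d d' (Psi : measurableType d) (T : measurableType d') (R : realType).
Variables (P : probability Psi R) (mu : probability T R) (n : nat).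
Variable X : 'I_n -> {mfun Psi >-> T}.
Hypothesis iidX : iid P mu X.

(** This is n times the empirical measure of S. *)
Definition hits (S : set T) (w : Psi) : R := \sum_i (`[< S (X i w) >] : nat)%:R.

Let pattern (S : set T) (b : {ffun 'I_n -> bool}) : set Psi :=
  \bigcap_(i in [set` [set: 'I_n]%SET]) X i @^-1` (if b i then S else ~` S).

Let measurable_pattern S b : measurable S -> measurable (pattern S b).
Proof.
move=> mS; apply: fin_bigcap_measurable => // i _.
rewrite -[X in measurable X]setTI; apply: measurable_funP => //.
by case: (b i) => //; exact: measurableC.
Qed.

Let hits_patternE S (Q : R -> bool) : [set w | Q (hits S w)] =
  \big[setU/set0]_(b : {ffun 'I_n -> bool} | Q (\sum_i (b i : nat)%:R)) pattern S b.
Proof.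
rewrite -bigcup_seq_cond; apply/seteqP; split=> [w /= Qw|w].
  exists [ffun i => `[< S (X i w) >]].
    rewrite /= mem_index_enum/=; move: Qw; congr (is_true (Q _)).
    by apply: eq_bigr => i _; rewrite ffunE.
  by move=> i _ /=; rewrite ffunE; case: asboolP.
move=> [b /andP[_ Qb] wb] /=; move: Qb; congr (is_true (Q _)).
apply: eq_bigr => i _; congr (nat_of_bool _)%:R.
have : (if b i then S else ~` S) (X i w) by apply: wb; rewrite /= finset.in_setT.
by case: (b i) => Sw; apply/esym; [apply/asboolP|apply/asboolPn].
Qed.

Lemma measurable_hits S (Q : R -> bool) : measurable S ->
  measurable [set w | Q (hits S w)].
Proof.
move=> mS; rewrite hits_patternE; apply: bigsetU_measurable => b _.
exact: measurable_pattern.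
Qed.

Let pattern_prob S b : measurable S ->
  P (pattern S b) = (\prod_i coin (fine (mu S)) (b i))%:E.
Proof.
move=> mS; rewrite (iidX.2 _ (fun i => if b i then S else ~` S)); last first.
  by move=> i _; case: (b i) => //; exact: measurableC.
rewrite -prodEFin; apply: eq_big => [i|i _]; first by rewrite finset.in_setT.
have -> A : measurable A -> P (X i @^-1` A) = mu A.
  by move=> mA; rewrite -(iidX.1 i).
rewrite /coin; case: (b i); first by rewrite fineK// fin_num_measure.
  by rewrite probability_setC// EFinB fineK// fin_num_measure.
by case: (b i) => //; exact: measurableC.
Qed.

(** Only the pattern of the tosses `X_i in S` matters, and independence gives its
probability as a product of coin weights. *)
Lemma hits_upper_tail S B : measurable S -> 0 < B <= 1 ->
  (P [set w | n%:R * (fine (mu S) + B) <= hits S w]%R <=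
    (expR (- (n%:R * B ^+ 2 / 8)))%:E)%E.
Proof.
move=> mS B01; rewrite (hits_patternE S (fun h => n%:R * (fine (mu S) + B) <= h)).
apply: le_trans (measure_le_bigsetU _ _ _) _ => [b|].
  exact: measurable_pattern.
rewrite (eq_bigr _ (fun b _ => pattern_prob b mS)).
rewrite sumEFin lee_fin; apply: chernoff_coins => //.
by rewrite -!lee_fin fineK ?fin_num_measure// measure_ge0 probability_le1.
Qed.

Lemma hits_setC S w : hits (~` S) w = n%:R - hits S w.
Proof.
rewrite -[n in RHS]card_ord -sumr_const -sumrB; apply: eq_bigr => i _.
rewrite asbool_neg; by case: asboolP => _; rewrite ?subrr ?subr0.
Qed.

(** The lower tail for S is the upper tail for the complement of S. *)
Lemma hits_deviation S B : measurable S -> 0 < B <= 1 ->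
  (P [set w | n%:R * B <= `|hits S w - n%:R * fine (mu S)|]%R <=
    (2 * expR (- (n%:R * B ^+ 2 / 8)))%:E)%E.
Proof.
move=> mS B01; rewrite mulr2n mulrDl mul1r EFinD.
have muC : fine (mu (~` S)) = 1 - fine (mu S).
  by rewrite probability_setC// fineB// fin_num_measure.
apply: le_trans _ (leeD (hits_upper_tail mS B01) (hits_upper_tail (measurableC mS) B01)).
apply: le_trans _ (measureU2 _ _ _); [|exact: (measurable_hits (fun h => _ <= h))..|].
  apply: le_measure; rewrite ?inE.
  - by apply: (measurable_hits (fun h => _ <= `|h - _|)).
  - by apply: measurableU; [exact: (measurable_hits (fun h => _ <= h))..|
       apply: (measurable_hits (fun h => _ <= h)); exact: measurableC].
  move=> w /=; rewrite hits_setC muC !mulrDr mulrN mulr1.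
  case: (ger0P (hits S w - n%:R * fine (mu S))) => h hB; [left|right]; lra.
by apply: (measurable_hits (fun h => _ <= h)); exact: measurableC.
Qed.
End empirical.

(** * Transporting a discrepancy along the edges of a graph *)

(** A simple path carries a unit flow from its first to its last vertex.
Simplicity ensures that no edge is used twice, so that the flow is the
indicator u of a set of edges. *)
Lemma simple_path_flow (R : realType) (K : finType) (adj : rel K) (p : seq K) (x : K) :
    path adj x p -> uniq (x :: p) ->
  exists u : K -> K -> bool,
    [/\ forall a b, u a b -> adj a b,
        forall a b, u a b -> a \in x :: p
      & forall b, \sum_a (u a b : nat)%:R - \sum_a (u b a : nat)%:R
          = (b == last x p : nat)%:R - (b == x : nat)%:R :> R].
Proof.
elim: p x => [x _ _|y p ih x].
  by exists (fun _ _ => false); split=> // b; rewrite !subrr.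
rewrite cons_uniq => /andP[xy yp] /andP[xNyp uyp].
have [u [uadj uin ubal]] := ih _ yp uyp.
have ux b : u x b = false by apply/negbTE; apply: contra xNyp => /uin.
exists (fun a b => u a b || (a == x) && (b == y)); split.
- by move=> a b /orP[/uadj//|/andP[/eqP-> /eqP->]].
- move=> a b /orP[/uin ain|/andP[/eqP-> _]]; rewrite in_cons ?eqxx//.
  by rewrite ain orbT.
move=> b.
have uE (a c : K) : ((u a c || (a == x) && (c == y)) : nat)%:R =
    (u a c : nat)%:R + (a == x : nat)%:R * (c == y : nat)%:R :> R.
  have [->|_]/= := eqVneq a x; last by rewrite orbF mul0r addr0.
  by rewrite ux add0r mul1r.
have sE (a : K) (c : R) : \sum_a' (a' == a : nat)%:R * c = c.
  by rewrite -mulr_suml (bigD1 a)//= eqxx big1 ?addr0 ?mul1r// => w /negPf->.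
under eq_bigr do rewrite uE.
under [X in _ - X]eq_bigr do rewrite uE mulrC.
rewrite !big_split/= sE.
under [X in _ - (_ + X)]eq_bigr do rewrite mulrC.
rewrite -mulr_sumr.
have -> : \sum_a (a == y : nat)%:R = 1 :> R.
  by rewrite (bigD1 y)//= eqxx big1 ?addr0// => w /negPf->.
by rewrite mulr1; have := ubal b; lra.
Qed.

(** The sets S a b collect the targets k whose path from the root uses the edge
(a, b); they depend on the graph only, so that they are at hand before p and q
(in practice, before the sample) are known.  Adding the constant circulation B
to the signed flow g makes it nonnegative and, the adjacency being symmetric,
does not change its divergence q - p.  A vertex then sends out at most 2 B along
each of its edges, hence at most p a, and keeps the rest. *)
Lemma routed_transport (R : realType) (K : finType) (adj : rel K) :
    (forall a b, adj a b = adj b a) -> (forall a, adj a a) ->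
    (forall a b, connect adj a b) ->
  exists S : K -> K -> {set K}, forall (p q : K -> R) (B : R) (Delta : nat),
    0 <= B -> \sum_k p k = \sum_k q k ->
    (forall a, (#|[set b | adj a b]%SET| <= Delta)%N) ->
    (forall a, 2 * B * Delta%:R <= p a) ->
    (forall a b, `| \sum_(k in S a b) (q k - p k) | <= B) ->
  exists T : K -> K -> R,
    [/\ forall a b, 0 <= T a b,
        forall a b, T a b != 0 -> adj a b,
        forall a, \sum_b T a b = p a
      & forall b, \sum_a T a b = q b].
Proof.
move=> adjC adjxx adjT.
have [root _|K0] := pickP (@predT K); last first.
  exists (fun _ _ => finset.set0) => p q B Delta *; exists (fun _ _ => 0).
  by split=> // a; have := K0 a.
have /choice[u uP] k : exists u : K -> K -> bool,
    (forall a b, u a b -> adj a b) /\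
    (forall b, \sum_a (u a b : nat)%:R - \sum_a (u b a : nat)%:R
          = (b == k : nat)%:R - (b == root : nat)%:R :> R).
  have /connectP[s rs ->] := adjT root k.
  case/shortenP : rs => s' rs' us' _.
  have [u [uadj _ ubal]] := simple_path_flow R rs' us'.
  by exists u; split.
exists (fun a b => [set k | u k a b]%SET) => p q B Delta B0 pq deg Bp Sle.
pose g a b := \sum_k (u k a b : nat)%:R * (q k - p k).
have gE a b : g a b = \sum_(k in [set k | u k a b]%SET) (q k - p k).
  rewrite [RHS]big_mkcond/=; apply: eq_bigr => k _; rewrite inE.
  by case: (u k a b); rewrite ?mul1r ?mul0r.
have gB a b : `|g a b| <= B by rewrite gE.
have gadj a b : ~~ adj a b -> g a b = 0.
  move=> Nab; rewrite /g big1// => k _.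
  case: (boolP (u k a b)) => [/(uP k).1 ab|_]; last by rewrite mul0r.
  by rewrite ab in Nab.
have gdiv b : \sum_a g a b - \sum_a g b a = q b - p b.
  rewrite /g exchange_big/= [X in _ - X]exchange_big/= -sumrB.
  transitivity (\sum_k ((b == k : nat)%:R - (b == root : nat)%:R) * (q k - p k)).
    apply: eq_bigr => k _; rewrite -(uP k).2 mulrBl -!mulr_suml//.
  under eq_bigr do rewrite mulrBl.
  rewrite sumrB -mulr_sumr [X in _ - _ * X]sumrB pq subrr mulr0 subr0.
  rewrite (bigD1 b)//= eqxx mul1r big1 ?addr0// => k kb.
  by rewrite eq_sym (negPf kb) mul0r.
(* the circulation B on all edges absorbs the sign of the flow g *)
pose t a b := g a b + B * (adj a b : nat)%:R.
have t0 a b : 0 <= t a b.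
  rewrite /t; case: (boolP (adj a b)) => [_|/gadj->]; last by rewrite mulr0 addr0.
  by rewrite mulr1; have := gB a b; rewrite ler_norml; lra.
have tdiv b : \sum_a t a b - \sum_a t b a = q b - p b.
  rewrite /t !big_split/= -gdiv.
  by under [X in _ + X - _]eq_bigr do rewrite adjC; lra.
have tout a : \sum_b t a b <= p a.
  apply: le_trans (Bp a).
  rewrite (bigID (adj a))/= [X in _ + X]big1 => [|b Nab]; last first.
    by rewrite /t gadj// (negPf Nab) mulr0 addr0.
  rewrite addr0 (@le_trans _ _ (\sum_(b | adj a b) 2 * B))//.
    apply: ler_sum => b ab; rewrite /t ab mulr1.
    by have := gB a b; rewrite ler_norml; lra.
  rewrite sumr_const -[X in X <= _]mulr_natr ler_wpM2l ?mulr_ge0// ler_nat.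
  by rewrite (leq_trans _ (deg a))// subset_leq_card//; apply/fintype.subsetP => b; rewrite inE.
have dE (x : K) (c : K -> R) : \sum_a (a == x : nat)%:R * c a = c x.
  by rewrite (bigD1 x)//= eqxx mul1r big1 ?addr0// => a /negPf->; rewrite mul0r.
(* the diagonal term is the mass that stays in its cell *)
exists (fun a b => t a b + (a == b : nat)%:R * (p a - \sum_c t a c)); split.
- move=> a b; rewrite addr_ge0// mulr_ge0// subr_ge0//.
- move=> a b; have [->//|_] := eqVneq a b; rewrite mul0r addr0.
  apply: contraR => Nab; rewrite /t gadj// (negPf Nab) mulr0 addr0//.
- move=> a; rewrite big_split/=.
  under [X in _ + X]eq_bigr do rewrite eq_sym.
  by rewrite dE addrC subrK.
- move=> b; rewrite big_split/= dE.
  by have := tdiv b; lra.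
Qed.

(** * Mixtures of restrictions of a measure, finite partitions *)

Section restriction_mixture.
Local Open Scope ereal_scope.
Context d (T : measurableType d) (R : realType) (mu : {measure set T -> \bar R}).
Variables (I : finType) (w : I -> {nonneg R}) (C : I -> set T).

Definition restriction_mixture (_ : forall i, measurable (C i))
    (_ : \sum_i (w i)%:num%:E * mu (C i) = 1) : set T -> \bar R :=
  fun A => \sum_i (w i)%:num%:E * mu (A `&` C i).

Hypotheses (mC : forall i, measurable (C i))
  (w1 : \sum_i (w i)%:num%:E * mu (C i) = 1).

Let nu := restriction_mixture mC w1.

Let nu0 : nu set0 = 0.
Proof. by rewrite /nu /restriction_mixture big1// => i _; rewrite set0I measure0 mule0. Qed.

Let nu_ge0 A : 0 <= nu A.
Proof. by apply: sume_ge0 => i _; rewrite mule_ge0. Qed.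

Let nu_sigma_additive : semi_sigma_additive nu.
Proof.
move=> F mF tF mUF; rewrite [X in X @ \oo --> _](_ : _ =
    (fun n => \sum_i \sum_(0 <= k < n) mscale (w i) (mrestr mu (mC i)) (F k))); last first.
  by apply/funext => n; rewrite exchange_big/=.
apply: cvg_nnesum => [i _|i _]; first by near=> n; exact: sume_ge0.
exact: (@measure_semi_sigma_additive _ _ _ (mscale (w i) (mrestr mu (mC i)))).
Unshelve. all: by end_near. Qed.

HB.instance Definition _ := isMeasure.Build _ _ _ nu nu0 nu_ge0 nu_sigma_additive.

Let nu_setT : nu [set: T] = 1.
Proof. by rewrite -w1; apply: eq_bigr => i _; rewrite setTI. Qed.

HB.instance Definition _ := Measure_isProbability.Build _ _ _ nu nu_setT.

(** The conditional laws used below are mixtures of restrictions of mu to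
cells; the weight of a cell is the proportion of mass that comes from it, divided by
its mass. *)
Lemma restriction_mixture_exists : exists nu : probability T R,
  forall A, nu A = \sum_i (w i)%:num%:E * mu (A `&` C i).
Proof. by exists nu. Qed.
End restriction_mixture.

Section finite_partition.
Context d (T : measurableType d) (R : realType) (mu : probability T R).
Variables (K : finType) (kappa : T -> K).
Hypothesis mkappa : forall k, measurable (kappa @^-1` [set k]).

Let preimage_bigsetU (S : {set K}) :
  [set x | kappa x \in S] = \big[setU/set0]_(k in S) kappa @^-1` [set k].
Proof.
rewrite -bigcup_seq_cond; apply/seteqP; split=> [x /= xS|x [k /= /andP[_ kS] xk]];
  last by rewrite /= xk.
by exists (kappa x) => //=; rewrite mem_index_enum.
Qed.

Lemma measurable_cells (S : {set K}) : measurable [set x | kappa x \in S].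
Proof. by rewrite preimage_bigsetU; apply: bigsetU_measurable. Qed.

Lemma measure_cells (S : {set K}) A : measurable A ->
  mu (A `&` [set x | kappa x \in S]) = (\sum_(k in S) mu (A `&` kappa @^-1` [set k]))%E.
Proof.
move=> mA.
have -> : A `&` [set x | kappa x \in S] =
    \bigcup_(k in [set` enum S]) (A `&` kappa @^-1` [set k]).
  apply/seteqP; split=> [x [Ax /= xS]|x [k /=]].
    by exists (kappa x) => //=; rewrite mem_enum.
  by rewrite mem_enum => kS [Ax /= xk]; split=> //=; rewrite xk.
rewrite measure_fin_bigcup.
- by rewrite -fsbig_seq ?enum_uniq// big_enum.
- exact: finite_finset.
- by move=> k l _ _ [x [[_ /= <-] [_ /= <-]]].
- by move=> k _; exact: measurableI.
Qed.

Lemma fine_measure_cells (S : {set K}) :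
  fine (mu [set x | kappa x \in S]) = \sum_(k in S) fine (mu (kappa @^-1` [set k])).
Proof.
rewrite -[X in mu X]setTI measure_cells// sum_fine => [|k _].
  by congr fine; apply: eq_bigr => k _; rewrite setTI.
by rewrite fin_num_measure.
Qed.
End finite_partition.

(** * From a transport plan between cells to a disintegration *)

Section plan.
Context (R : realType) (T : polishMetricType R) (mu : probability (Borel T) R).
Variables (K : finType) (kappa : T -> K).
Hypothesis mkappa : forall k, measurable (kappa @^-1` [set k] : set (Borel T)).

Let p k : R := fine (mu (kappa @^-1` [set k])).

(** F a b is the mass moved from the cell a to the cell b.  The law attached to
x_i in the cell b takes the proportion F a b / q b of its mass from mu conditioned
on a.  When b contains no x_i the column F _ b vanishes, so nothing is lost by
summing over the sample only. *)
Lemma disintegration_of_plan (n : nat) (x : 'I_n -> T) (r : R) (F : K -> K -> R) :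
    (forall k, 0 < p k) -> (forall a b, 0 <= F a b) ->
    (forall a b, F a b != 0 -> forall y z, kappa y = a -> kappa z = b -> mdist z y <= r) ->
    (forall a, \sum_b F a b = p a) ->
    (forall b, \sum_a F a b = n%:R^-1 * \sum_i (kappa (x i) == b : nat)%:R) ->
  has_disintegration mu x r.
Proof.
move=> p0 F0 Fr Fp Fq.
pose q b := n%:R^-1 * \sum_i (kappa (x i) == b : nat)%:R : R.
have q0 i : 0 < q (kappa (x i)).
  have n0 : (0 < n)%N by case: n i {x Fq q} => // -[].
  rewrite /q mulr_gt0 ?invr_gt0 ?ltr0n// (bigD1 i)//= eqxx ltr_pwDl//.
  by apply: sumr_ge0.
have w0 i a : 0 <= F a (kappa (x i)) / (q (kappa (x i)) * p a).
  by rewrite divr_ge0// mulr_ge0// ltW.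
pose w i a := NngNum (w0 i a).
have muC a : mu (kappa @^-1` [set a]) = (p a)%:E by rewrite fineK// fin_num_measure.
have w1 i : (\sum_a (w i a)%:num%:E * mu (kappa @^-1` [set a]) = 1)%E.
  under eq_bigr do rewrite muC -EFinM/=.
  rewrite sumEFin; congr EFin.
  transitivity (\sum_a F a (kappa (x i)) / q (kappa (x i))).
    apply: eq_bigr => a _; rewrite invfM mulrA mulfVK// gt_eqF//.
  by rewrite -mulr_suml Fq -/(q _) divff// gt_eqF.
pose nu i := projT1 (cid (restriction_mixture_exists mkappa (w1 i))).
have nuE i A : (nu i A = \sum_a (w i a)%:num%:E * mu (A `&` kappa @^-1` [set a]))%E.
  by rewrite /nu; case: cid => /= ? ->.
exists nu; split=> [i|A mA].
  rewrite nuE -[RHS](w1 i); apply: eq_bigr => a _.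
  have [F0a|Fa] := eqVneq (F a (kappa (x i))) 0.
    by rewrite /= F0a mul0r !mul0e.
  congr (_ * mu _)%E; apply/setIidPr => y /= ya.
  exact: Fr Fa _ _ ya erefl.
pose m a := fine (mu (A `&` kappa @^-1` [set a])).
have mE a : mu (A `&` kappa @^-1` [set a]) = (m a)%:E.
  by rewrite fineK// fin_num_measure//; apply: measurableI.
have muA : mu A = (\sum_a m a)%:E.
  rewrite -[A in LHS]setIT (_ : setT = [set y | kappa y \in [set: K]%SET]).
    rewrite measure_cells// -sumEFin; apply: eq_big => [a|a _].
      by rewrite finset.in_setT.
    exact: mE.
  by apply/seteqP; split=> // y _ /=; rewrite finset.in_setT.
rewrite muA (eq_bigr _ (fun i _ => nuE i A)).
under eq_bigr do under eq_bigr do rewrite mE -EFinM.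
under eq_bigr do rewrite sumEFin.
rewrite sumEFin -EFinM; congr EFin; rewrite exchange_big/= mulr_sumr.
apply: eq_bigr => a _; rewrite -mulr_suml mulrA.
rewrite -[LHS]mul1r; congr (_ * _).
rewrite (partition_big (fun i => kappa (x i)) xpredT)//=.
transitivity (\sum_b F a b / p a).
  by rewrite -mulr_suml Fp divff// gt_eqF.
rewrite mulr_sumr; apply: eq_bigr => b _.
under eq_bigr => i /eqP-> do over.
rewrite sumr_const.
have [qb0|qb] := eqVneq (q b) 0.
  have -> : F a b = 0.
    apply/eqP; rewrite eq_le F0 andbT -qb0 -[q b]Fq (bigD1 a)//= lerDl.
    exact: sumr_ge0.
  by rewrite !mul0r mul0rn mulr0.
rewrite -(mulr_natl (F a b / _)) !mulrA.
rewrite (_ : _ * _%:R = q b); last first.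
  rewrite /q; congr (_ * _); rewrite -sum1_card natr_sum [LHS]big_mkcond/=.
  apply: eq_bigr => i _.
  by rewrite -topredE/= -[X in if X then _ else _]/(kappa (x i) == b); case: eqP.
by rewrite invfM mulrACA divff// mul1r.
Qed.
End plan.

(** * Disintegration with high probability *)

Lemma hits_cells d d' (Psi : measurableType d) (T : measurableType d')
    (R : realType) (n : nat) (X : 'I_n -> {mfun Psi >-> T}) (K : finType)
    (kappa : T -> K) (S : {set K}) (w : Psi) :
  hits R X [set x | kappa x \in S] w =
  \sum_(k in S) \sum_i (kappa (X i w) == k : nat)%:R.
Proof.
rewrite exchange_big/=; apply: eq_bigr => i _; rewrite asboolb.
case: (boolP (kappa (X i w) \in S)) => [kS|kNS].
  by rewrite (bigD1 (kappa (X i w)))//= eqxx big1 ?addr0// => k /andP[_ /negPf];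
    rewrite eq_sym => ->.
by rewrite big1// => k kS; case: eqP => // kE; rewrite kE kS in kNS.
Qed.

(** The bad event is that the empirical measure deviates by B on one of the sets
of cells S a b of [routed_transport]; a union bound over the pairs (a, b) gives
eps. *)
Lemma cells_disintegrable (R : realType) (T : polishMetricType R)
    (mu : probability (Borel T) R) (K : finType) (kappa : T -> K) (adj : rel K)
    (Delta n : nat) (B eps r : R) :
    (forall k, measurable (kappa @^-1` [set k] : set (Borel T))) ->
    (forall a b, adj a b = adj b a) -> (forall a, adj a a) ->
    (forall a b, connect adj a b) ->
    (forall a, (#|[set b | adj a b]%SET| <= Delta)%N) ->
    (forall y z, adj (kappa y) (kappa z) -> mdist y z <= r) ->
    (0 < n)%N -> 0 < B <= 1 ->
    (forall k, 2 * B * Delta%:R <= fine (mu (kappa @^-1` [set k]))) ->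
    2 * #|K|%:R ^+ 2 * expR (- (n%:R * B ^+ 2 / 8)) <= eps ->
  disintegrable mu n eps r.
Proof.
move=> mkappa adjC adjxx adjT deg close n0 B01 Bmu Keps d Psi P X iidX.
have [S Sroute] := routed_transport R adjC adjxx adjT.
pose cells (ab : K * K) : set (Borel T) := [set x | kappa x \in S ab.1 ab.2].
have mcells ab : measurable (cells ab) by exact: measurable_cells.
pose bad (ab : K * K) : set Psi := [set w | n%:R * B <=
  `|hits R X (cells ab) w - n%:R * fine (mu (cells ab))|].
have mbad ab : measurable (bad ab).
  exact: (measurable_hits X (fun h => n%:R * B <= `|h - n%:R * fine (mu (cells ab))|)).
have mB : measurable (\big[setU/set0]_ab bad ab) by exact: bigsetU_measurable.
exists (~` \big[setU/set0]_ab bad ab); split; first exact: measurableC.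
  rewrite probability_setC// EFinB leeB//.
  apply: le_trans (measure_le_bigsetU _ _ mbad) _.
  apply: (@le_trans _ _ (\sum_(ab : K * K) (2 * expR (- (n%:R * B ^+ 2 / 8)))%:E)%E).
    by apply: lee_sum => ab _; exact: hits_deviation.
  rewrite sumEFin lee_fin sumr_const card_prod; apply: le_trans Keps.
  by rewrite -[leLHS]mulr_natl natrM expr2 mulrCA mulrA.
move=> w wE.
have nR0 : 0 < n%:R :> R by rewrite ltr0n.
have good a b : `|hits R X (cells (a, b)) w - n%:R * fine (mu (cells (a, b)))| <= n%:R * B.
  apply: contrapT => /negP; rewrite -ltNge => ab; apply: wE.
  by rewrite -bigcup_seq; exists (a, b); [exact: mem_index_enum|exact: ltW].
pose p k : R := fine (mu (kappa @^-1` [set k])).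
pose q k : R := n%:R^-1 * \sum_i (kappa (X i w) == k : nat)%:R.
have Delta0 (a : K) : 0 < Delta%:R :> R.
  rewrite ltr0n (leq_trans _ (deg a))//.
  by apply/card_gt0P; exists a; rewrite inE.
have [|||||F [F0 Fadj Fp Fq]] := Sroute p q B Delta.
- by case/andP: B01 => /ltW.
- transitivity (1 : R).
    transitivity (\sum_(k in [set: K]%SET) p k).
      by apply: eq_bigl => k; rewrite finset.in_setT.
    rewrite -fine_measure_cells// (_ : [set x | _] = setT) ?probability_setT//.
    by apply/seteqP; split=> // x _ /=; rewrite finset.in_setT.
  rewrite -mulr_sumr exchange_big/= (eq_bigr (fun=> 1)) => [|i _].
    by rewrite sumr_const card_ord mulVf ?gt_eqF.
  by rewrite (bigD1 (kappa (X i w)))//= eqxx big1 ?addr0// => k /negPf; rewrite eq_sym => ->.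
- exact: deg.
- exact: Bmu.
- move=> a b; have := good a b; rewrite /cells/= fine_measure_cells// hits_cells.
  rewrite -ler_pdivrMl// -[X in X * _]ger0_norm ?invr_ge0//.
  by rewrite -normrM mulrBr mulKf ?gt_eqF// sumrB mulr_sumr.
apply: (disintegration_of_plan mkappa (F := F)) => //.
- by move=> k; rewrite (lt_le_trans _ (Bmu k))// !mulr_gt0// ?(Delta0 k)//; case/andP: B01.
- by move=> a b /Fadj ab y z ya zb; apply: close; rewrite ya zb adjC.
Qed.

(** * The rate given by grids of every fineness *)

(** Partitions of T, of every fineness M, into at most N * M^D cells which behave
like the cells of a D-dimensional grid of mesh 1 / M.  The function kappa sends a
point to its cell; the constants are the same for all M. *)
Definition has_grids (R : realType) (T : polishMetricType R)
    (mu : probability (Borel T) R) (D : nat) : Prop :=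
  exists (N Delta : nat) (c L : R), [/\ (0 < Delta)%N, 0 < c, 0 <= L &
    forall M : nat, (0 < M)%N ->
    exists (K : finType) (kappa : T -> K) (adj : rel K),
      [/\ forall k, measurable (kappa @^-1` [set k] : set (Borel T)),
          [/\ forall a b, adj a b = adj b a, forall a, adj a a,
              forall a b, connect adj a b &
              forall a, (#|[set b | adj a b]%SET| <= Delta)%N],
          forall y z, adj (kappa y) (kappa z) -> mdist y z <= L / M%:R,
          forall k, c / M%:R ^+ D <= fine (mu (kappa @^-1` [set k]))
        & (#|K| <= N * M ^ D)%N]].

Section rate.
Variable R : realType.

(** The square of the order of magnitude of the empirical deviations. *)
Definition rate_base (n : nat) : R := ln n%:R / n%:R.

Lemma rate_base_ge0 n : 0 <= rate_base n.
Proof.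
case: n => [|n]; first by rewrite /rate_base invr0 mulr0.
by rewrite divr_ge0// ln_ge0// ler1n.
Qed.

(** Any positive lower bound will do; this one is ln n >= 1 - 1 / n. *)
Lemma ln_ge_half n : (2 <= n)%N -> 1 / 2 <= ln n%:R :> R.
Proof.
move=> n2; have n0 : 0 < n%:R :> R by rewrite ltr0n (leq_trans _ n2).
have := @le_ln1Dx R (n%:R^-1 - 1).
have -> : 1 + (n%:R^-1 - 1) = n%:R^-1 :> R by ring.
rewrite lnV ?posrE//.
have i0 : 0 < n%:R^-1 :> R by rewrite invr_gt0.
have i2 : n%:R^-1 <= 1 / 2 :> R.
  by rewrite div1r lef_pV2 ?posrE// ler_nat.
have h1 : -1 < n%:R^-1 - 1 :> R by lra.
by move=> /(_ h1); lra.
Qed.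

Lemma rate_base_gt0 n : (2 <= n)%N -> 0 < rate_base n.
Proof.
move=> n2; rewrite divr_gt0 ?ltr0n ?(leq_trans _ n2)//.
by apply: lt_le_trans (ln_ge_half n2).
Qed.

Lemma powRN_small (a e : R) : 0 < a -> 0 < e ->
  \forall n \near \oo, n%:R `^ (- a) < e.
Proof.
move=> a0 e0; near=> n.
have n0 : 0 < n%:R :> R by near: n; exists 1%N => // n /=; rewrite ltr0n.
have ne : (e^-1) `^ a^-1 < n%:R by near: n; exact: nbhs_infty_gtr.
rewrite powRN -[ltRHS]invrK ltf_pV2 ?posrE ?invr_gt0 ?powR_gt0//.
have <- : (e^-1 `^ a^-1) `^ a = e^-1.
  by rewrite -powRrM mulVf ?gt_eqF// powRr1// invr_ge0 ltW.
by apply: gt0_ltr_powR => //; rewrite nnegrE ?powR_ge0// ltW.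
Unshelve. all: by end_near. Qed.

(** As ln x < x at x = sqrt n, ln n / n is at most 2 / sqrt n. *)
Lemma rate_base_powR_small (a e : R) : 0 < a -> 0 < e ->
  \forall n \near \oo, rate_base n `^ a < e.
Proof.
move=> a0 e0; near=> n.
have n2 : (2 <= n)%N by near: n; exists 2%N.
have n0 : 0 < n%:R :> R by rewrite ltr0n (leq_trans _ n2).
have sn : rate_base n <= 2 * n%:R `^ (- (1 / 2)).
  have h := @ln_sublinear R (n%:R `^ (1 / 2)) (powR_gt0 _ n0).
  rewrite ln_powR in h.
  rewrite /rate_base ler_pdivrMr// -mulrA.
  have -> : n%:R `^ (- (1 / 2)) * n%:R = n%:R `^ (1 / 2) :> R.
    rewrite -[X in _ * X = _](powRr1 (ltW n0)) -powRD ?(gt_eqF n0) ?implybT//.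
    by congr (_ `^ _); field.
  by lra.
have : n%:R `^ (- (1 / 2)) < e `^ a^-1 / 2 :> R.
  by near: n; apply: powRN_small; rewrite ?divr_gt0 ?powR_gt0.
move=> ne; have {ne sn} : rate_base n < e `^ a^-1 by lra.
move=> sn; have <- : (e `^ a^-1) `^ a = e.
  by rewrite -powRrM mulVf ?gt_eqF// powRr1// ltW.
by apply: gt0_ltr_powR => //; rewrite nnegrE ?powR_ge0// rate_base_ge0.
Unshelve. all: by end_near. Qed.

Lemma cvg0_of_small (u : nat -> R) : (forall n, 0 <= u n) ->
  (forall e, 0 < e -> \forall n \near \oo, u n < e) -> u @ \oo --> 0.
Proof.
move=> u0 ue; apply/cvgrPdist_lt => e e0; apply: filterS (ue e e0) => n un.
by rewrite sub0r normrN ger0_norm.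
Qed.

(** Take deviations B = b sigma with sigma = sqrt (ln n / n) and
b^2 = 8 (alpha + 2), so that exp (- n B^2 / 8) = n^(- alpha - 2), and the finest
grid whose cells have mass at least 2 B Delta, that is M^D about y / sigma.  It
has O(sqrt n) cells, hence O(n) pairs of them, and mesh O(sigma^(1 / D)). *)
Lemma grids_rate (T : polishMetricType R) (mu : probability (Borel T) R)
    (D : nat) (alpha : R) : 0 < alpha -> (0 < D)%N -> has_grids mu D ->
  asymptotically_disintegrable_O mu (fun n => n%:R `^ (- alpha))
    (fun n => (ln n%:R / n%:R) `^ (1 / (2 * D%:R))).
Proof.
move=> alpha0 D0 [N [Delta [c [L [Delta0 c0 L0 grids]]]]].
have DR0 : 0 < D%:R :> R by rewrite ltr0n.
have DeltaR0 : 0 < Delta%:R :> R by rewrite ltr0n.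
pose b : R := Num.sqrt (8 * (alpha + 2)).
have b0 : 0 < b by rewrite sqrtr_gt0; lra.
have bb : b ^+ 2 = 8 * (alpha + 2) by rewrite sqr_sqrtr//; lra.
pose y := c / (2 * b * Delta%:R).
have y0 : 0 < y by rewrite divr_gt0// !mulr_gt0.
pose beta : R := 1 / (2 * D%:R).
have beta0 : 0 < beta by rewrite divr_gt0// mulr_gt0.
pose A := 2 * L * (y `^ (D%:R^-1))^-1.
have A0 : 0 <= A by rewrite !mulr_ge0// invr_ge0 powR_ge0.
exists (fun n => n%:R `^ (- alpha)), (fun n => A * rate_base n `^ beta).
split; last 2 first.
- apply/eqOP; near=> k; near=> n.
  by rewrite ler_peMl.
- apply/eqOP; near=> k; near=> n.
  by rewrite normrM ler_wpM2r// ger0_norm//; near: k; exact: nbhs_pinfty_ge.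
split.
- by move=> n; rewrite powR_ge0 mulr_ge0// powR_ge0.
- by apply: cvg0_of_small => [n|e e0]; [exact: powR_ge0|exact: powRN_small].
- rewrite -[X in _ --> X](mulr0 A); apply: cvgMr.
  by apply: cvg0_of_small => [n|e e0]; [exact: powR_ge0|exact: rate_base_powR_small].
near=> n.
have n2 : (2 <= n)%N by near: n; exists 2%N.
have n0 : 0 < n%:R :> R by rewrite ltr0n (leq_trans _ n2).
have ln0 := ln_ge_half n2.
have s0 := rate_base_gt0 n2.
pose sigma := rate_base n `^ (1 / 2).
have sig0 : 0 < sigma by exact: powR_gt0.
have sigb : sigma < b^-1.
  by rewrite /sigma; near: n; apply: rate_base_powR_small; rewrite ?invr_gt0//; lra.
have sigy : sigma < y.
  by rewrite /sigma; near: n; apply: rate_base_powR_small => //; lra.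
have nbig : 4 * (N%:R * y) ^+ 2 < n%:R by near: n; exact: nbhs_infty_gtr.
have sig2 : sigma ^+ 2 = ln n%:R / n%:R.
  rewrite -powR_mulrn ?powR_ge0// -powRrM.
  by rewrite mul1r mulVf// powRr1// rate_base_ge0.
pose z := (y / sigma) `^ D%:R^-1.
have z1 : 1 <= z.
  have <- : 1 `^ D%:R^-1 = 1 :> R by rewrite powR1.
  have yz : 1 <= y / sigma by rewrite ler_pdivlMr// mul1r ltW.
  by apply: ge0_ler_powR; rewrite ?nnegrE ?invr_ge0 ?ler01// (le_trans _ yz).
have ys0 : 0 <= y / sigma by rewrite divr_ge0 ?(ltW y0) ?(ltW sig0).
have zD : z ^+ D = y / sigma.
  by rewrite -powR_mulrn ?powR_ge0// -powRrM mulVf ?gt_eqF// powRr1.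
(* z >= 1, so rounding down at most halves it: z < M + 1 <= 2 M *)
pose M := Num.truncn z.
have z0 : 0 <= z by lra.
have /andP[Mz zM] := Num.Theory.truncn_itv z0.
have M0 : (0 < M)%N.
  by rewrite Num.Theory.truncn_gt0.
have [K [kappa [adj [mk [adjC adjxx adjT deg] close mass cardK]]]] := grids M M0.
have MR0 : 0 < M%:R :> R by rewrite ltr0n.
have MD : M%:R ^+ D <= y / sigma by rewrite -zD lerXn2r// nnegrE// ltW.
apply: (cells_disintegrable (B := b * sigma) mk adjC adjxx adjT deg).
- move=> u v /close /le_trans; apply.
  have -> : A * rate_base n `^ beta = 2 * L / z.
    have sE : rate_base n `^ beta = sigma `^ D%:R^-1.
      by rewrite -powRrM; congr (_ `^ _); rewrite /beta; field; rewrite gt_eqF.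
    have yE : y `^ D%:R^-1 = z * sigma `^ D%:R^-1.
      by rewrite -powRM ?ys0 ?ltW// divfK ?gt_eqF.
    have sD0 : 0 < sigma `^ D%:R^-1 by exact: powR_gt0.
    by rewrite /A yE sE; field; rewrite !gt_eqF//; lra.
  rewrite ler_pdivrMr// mulrAC ler_pdivlMr; last by lra.
  rewrite [2 * L]mulrC -mulrA ler_wpM2l//.
  have : 1 <= M%:R :> R by rewrite ler1n.
  by move: zM; rewrite -natr1; lra.
- exact: leq_trans n2.
- rewrite mulr_gt0//= -ler_pdivlMl// mulr1; exact: ltW.
- move=> k; apply: le_trans (mass k).
  rewrite ler_pdivlMr ?exprn_gt0//.
  apply: (@le_trans _ _ (2 * (b * sigma) * Delta%:R * (y / sigma))).
    by rewrite ler_wpM2l// !mulr_ge0// ltW.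
  rewrite /y le_eqVlt; apply/orP; left; apply/eqP; field.
  by rewrite !gt_eqF.
have -> : n%:R * (b * sigma) ^+ 2 / 8 = (alpha + 2) * ln n%:R.
  by rewrite exprMn bb sig2; field; rewrite gt_eqF.
have -> : expR (- ((alpha + 2) * ln n%:R)) = n%:R `^ (- alpha) * (n%:R ^+ 2)^-1 :> R.
  rewrite -mulNr mulrC expRM lnK ?posrE// opprD powRD ?(gt_eqF n0) ?implybT//.
  by rewrite powR_invn// ltW.
rewrite mulrCA -[leRHS]mulr1 ler_wpM2l ?powR_ge0//.
rewrite ler_pdivrMr ?exprn_gt0// mul1r.
have K2 : #|K|%:R ^+ 2 <= (N%:R * (y / sigma)) ^+ 2 :> R.
  apply: lerXn2r; rewrite ?nnegrE//; first exact: mulr_ge0.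
  apply: (@le_trans _ _ (N * M ^ D)%N%:R); first by rewrite ler_nat.
  by rewrite natrM natrX ler_wpM2l.
have yn : (N%:R * (y / sigma)) ^+ 2 <= 2 * (N%:R * y) ^+ 2 * n%:R.
  rewrite mulrA expr_div_n sig2 invf_div mulrA ler_pdivrMr; last by lra.
  have : 0 <= (N%:R * y) ^+ 2 * n%:R by rewrite mulr_ge0// ?sqr_ge0// ltW.
  by move=> h; nra.
have : 4 * (N%:R * y) ^+ 2 * n%:R <= n%:R * n%:R by rewrite ler_wpM2r// ltW.
by rewrite -expr2; lra.
Unshelve. all: by end_near. Qed.
End rate.

(** * Cells from covers, and subdivisions of the unit interval *)

(** A point in several sets is given to one of them by a choice which depends
only on the list of the sets that contain it; this makes the partition
measurable.  Points in a single set of the cover are certain to go there, which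
is enough to bound below the mass of the cells. *)
Lemma cells_of_cover d (T : measurableType d) (K : finType) (A : K -> set T) :
    (forall k, measurable (A k)) -> (forall x, exists k, A k x) ->
  exists kappa : T -> K,
    [/\ forall x, A (kappa x) x,
        forall k, measurable (kappa @^-1` [set k])
      & forall k x, A k x -> (forall j, A j x -> j = k) -> kappa x = k].
Proof.
move=> mA cov.
pose pat x : {set K} := [set k | `[< A k x >]]%SET.
have patP x k : reflect (A k x) (k \in pat x) by rewrite inE; exact: asboolP.
have ex x : exists k, k \in pat x by have [k /patP] := cov x; exists k.
pose kappa x := xchoose (ex x).
have kappaA x : A (kappa x) x by apply/patP; exact: xchooseP.
exists kappa; split=> //; last by move=> k x _; apply.
(* B S is the set of the points that lie in A j for j in S and in no other A j *)
move=> k; pose B (S : {set K}) : set T :=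
  \bigcap_(j in [set: K]) (if j \in S then A j else ~` A j).
have BE S x : B S x <-> pat x = S.
  split=> [Bx|<- j _]; last by case: ifPn => [/patP|/patP].
  apply/setP => j; have := Bx j I; case: ifPn => jS.
    by move/patP.
  by move=> /= NA; apply/negbTE/patP.
rewrite (_ : _ @^-1` _ = \big[setU/set0]_(S | `[< exists2 x, pat x = S & kappa x = k >]) B S).
  apply: bigsetU_measurable => S _; apply: fin_bigcap_measurable => // j _.
  by case: ifP => _ //; exact: measurableC.
rewrite -bigcup_seq_cond; apply/seteqP; split=> [x /= xk|x [S /= /andP[_ /asboolP[y yS <-]] /BE xS]].
  exists (pat x) => /=; last exact/BE.
  by rewrite mem_index_enum/=; apply/asboolP; exists x.
by rewrite /= /kappa; apply: eq_xchoose => j; rewrite yS xS.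
Qed.

Lemma density_lower_bound d (T : measurableType d) (R : realType)
    (lam mu : probability T R) : has_bounded_density lam mu ->
  exists2 c : R, 0 < c & forall A, measurable A -> (c%:E * lam A <= mu A)%E.
Proof.
move=> [f [mf [c [C [c0 fcC]]] muE]]; exists c => // A mA.
rewrite muE// -integral_cst//; apply: ge0_le_integral => //.
- by move=> x _; rewrite lee_fin ltW.
- by apply/measurable_realfun.measurable_EFinP; exact: measurable_funTS.
- by move=> x _; rewrite lee_fin; case/andP: (fcC x).
Qed.

Lemma continuous_I_val (R : realType) :
  continuous (fun t : unit_interval R => val t).
Proof.
move=> x; apply/(@cvgrPdist_lt _ R _ _ (nbhs_filter x)) => e e0.
by apply: filterS (nbhsx_ballx x e e0) => y; rewrite ballEmdist.
Qed.

Lemma measurable_I_segment (R : realType) (a b : R) :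
  measurable ([set t | a < val t < b] : set (Borel (unit_interval R))).
Proof.
apply: sub_sigma_algebra.
have /continuousP/(_ _ (@interval_open R (BRight a) (BLeft b) isT isT)) := @continuous_I_val R.
by congr open; apply/seteqP; split=> t; rewrite /= in_itv.
Qed.

Lemma I_uniform_segment (R : realType) (a b : R) : 0 <= a -> a <= b -> b <= 1 ->
  I_uniform [set t : unit_interval R | a < val t < b] = (b - a)%:E.
Proof.
move=> a0 ab b1; rewrite /I_uniform /image_law /distribution /pushforward /=.
rewrite /uniform_prob integral_uniform_pdf.
rewrite (_ : _ `&` _ = `]a, b[%classic); last first.
  apply/seteqP; split=> [x [xab]|x]; rewrite /= !in_itv/= => x01.
    by rewrite -(val_clamp x01).
  have xI : 0 <= x <= 1 by case/andP: x01 => ? ?; apply/andP; split; lra.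
  by split=> //; move: x01; rewrite -{1 2}(val_clamp xI).
rewrite (eq_integral (fun=> 1%E)) => [|x]; last first.
  rewrite inE/= in_itv/= => /andP[ax xb].
  rewrite /uniform_pdf ifT ?subr0 ?invr1//.
  by apply/andP; split; lra.
rewrite integral_cst//= mul1e lebesgue_measure_itv/= lte_fin.
case: ifPn => [_|]; first by rewrite EFinD.
by rewrite -leNgt => ba; rewrite (_ : b - a = 0)//; lra.
Qed.

Lemma card_ord_le_size (M : nat) (S : {set 'I_M}) (s : seq nat) :
  (forall j : 'I_M, j \in S -> (j : nat) \in s) -> (#|S| <= size s)%N.
Proof.
move=> Ss; rewrite cardE -(size_map val) uniq_leq_size//.
  by rewrite map_inj_uniq ?enum_uniq//; exact: val_inj.
by move=> _ /mapP[j + ->]; rewrite mem_enum => /Ss.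
Qed.

Lemma card_near_ord (M : nat) (j : 'I_M) :
  (#|[set k : 'I_M | (j <= k.+1)%N && (k <= j.+1)%N]%SET| <= 3)%N.
Proof.
apply: (@card_ord_le_size _ _ [:: j.-1; j : nat; j.+1]) => k.
by rewrite !inE; lia.
Qed.

Lemma grid_index_exists (R : realType) (M : nat) (x : R) : (0 < M)%N -> 0 <= x <= 1 ->
  exists j : 'I_M, j%:R / M%:R <= x <= j.+1%:R / M%:R.
Proof.
move=> M0 /andP[x0 x1]; have MR0 : 0 < M%:R :> R by rewrite ltr0n.
have Mx0 : 0 <= M%:R * x by rewrite mulr_ge0.
have /andP[lo hi] := Num.Theory.truncn_itv Mx0.
have [mM|Mm] := ltnP (Num.truncn (M%:R * x)) M.
  exists (Ordinal mM); rewrite /= ler_pdivrMr// ler_pdivlMr//.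
  by rewrite ![x * _]mulrC lo ltW.
have M1 : (M.-1 < M)%N by rewrite prednK.
(* the remaining case is x = 1, which belongs to the last interval *)
exists (Ordinal M1); rewrite /= prednK// divff ?gt_eqF// x1 andbT.
rewrite ler_pdivrMr// mulrC; apply: le_trans lo; rewrite ler_nat; lia.
Qed.

Lemma grid_index_unique (R : realType) (M : nat) (x : R) (j k : 'I_M) : (0 < M)%N ->
  j%:R / M%:R < x < j.+1%:R / M%:R -> k%:R / M%:R <= x <= k.+1%:R / M%:R -> k = j.
Proof.
move=> M0 /andP[jx xj] /andP[kx xk]; have MR0 : 0 < M%:R :> R by rewrite ltr0n.
have := lt_le_trans jx xk; have := le_lt_trans kx xj.
rewrite !ltr_pM2r ?invr_gt0// !ltr_nat !ltnS => kj jk.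
by apply/val_inj/eqP; rewrite eqn_leq kj jk.
Qed.

(** * Grids on spaces made of arcs *)

Definition arc_end (R : realType) (t : unit_interval R) : bool :=
  (val t == 0) || (val t == 1).

Definition linked_arcs (R : realType) (T : Type) (F : finType)
    (phi : F -> unit_interval R -> T) : rel F :=
  fun e e' => `[< exists s t, [/\ arc_end s, arc_end t & phi e s = phi e' t] >].

Section arcs.
Context (R : realType) (T : polishMetricType R) (lam mu : probability (Borel T) R).
Local Notation I := (unit_interval R).
Variables (F : finType) (phi : F -> I -> T) (L w : R).
(* by phi_inj arcs meet, each other or themselves, at their end points only *)
Hypotheses (L0 : 0 <= L)
  (phi_lip : forall e s t, mdist (phi e s) (phi e t) <= L * mdist s t)
  (phi_cover : forall x, exists e t, phi e t = x)
  (phi_inj : forall e s e' t, 0 < val s < 1 -> phi e s = phi e' t -> e = e' /\ s = t)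
  (phi_link : forall e e', connect (linked_arcs phi) e e')
  (w0 : 0 < w)
  (lam_arc : forall e (A : set (Borel T)), measurable A ->
     (w%:E * I_uniform (phi e @^-1` A : set (Borel I)) <= lam A)%E)
  (muf : has_bounded_density lam mu).

Let phi_cont e : continuous (phi e).
Proof. exact: lipschitz_cont (phi_lip e). Qed.

Section subdivision.
Variable (M : nat).
Hypothesis M0 : (0 < M)%N.
Let MR0 : 0 < M%:R :> R. Proof. by rewrite ltr0n. Qed.

Definition piece (k : F * 'I_M) : set T := (phi k.1 \o clamp) @`
  `[k.2%:R / M%:R, k.2.+1%:R / M%:R]%classic.

Lemma measurable_piece k : measurable (piece k : set (Borel T)).
Proof.
rewrite -[piece k]setCK; apply: measurableC; apply: sub_sigma_algebra.
rewrite openC; apply: compact_closed; first exact: metric_hausdorff.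
apply: continuous_compact; last exact: segment_compact.
apply: continuous_subspaceT => x; apply: continuous_comp; first exact: clamp_cont.
exact: phi_cont.
Qed.

Let pt_bound (j : 'I_M) : 0 <= j%:R / M%:R :> R /\ j.+1%:R / M%:R <= 1 :> R.
Proof.
split; first by rewrite divr_ge0.
by rewrite ler_pdivrMr// mul1r ler_nat.
Qed.

Lemma pieceP k x : piece k x <->
  exists2 t : I, k.2%:R / M%:R <= val t <= k.2.+1%:R / M%:R & phi k.1 t = x.
Proof.
have [b0 b1] := pt_bound k.2; split.
  move=> [t]; rewrite /= in_itv/= => tk <-; exists (clamp t) => //.
  by rewrite val_clamp//; case/andP: tk => *; apply/andP; split; lra.
by move=> [t tk <-]; exists (val t); rewrite /= ?in_itv//= clampK.
Qed.

Lemma piece_cover x : exists k, piece k x.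
Proof.
have [e [t <-]] := phi_cover x.
have [j tj] := grid_index_exists M0 (valP t).
by exists (e, j); apply/pieceP; exists t.
Qed.

Lemma piece_diam k x y : piece k x -> piece k y -> mdist x y <= L / M%:R.
Proof.
move=> /pieceP[s /andP[s1 s2] <-] /pieceP[t /andP[t1 t2] <-].
apply: le_trans (phi_lip _ _ _) _; rewrite ler_wpM2l//.
rewrite -natr1 mulrDl div1r in s2 t2.
change (`|val s - val t| <= M%:R^-1); rewrite ler_norml; lra.
Qed.

Lemma piece_touch e (j j' : 'I_M) : (j <= j'.+1)%N -> (j' <= j.+1)%N ->
  exists x, piece (e, j) x /\ piece (e, j') x.
Proof.
wlog jj : j j' / (j <= j')%N => [wl|_ j'j].
  move=> h1 h2; have /orP[/wl|/wl] := leq_total j j'; first exact.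
  by move=> /(_ h2 h1)[x [? ?]]; exists x.
have [b0 b1] := pt_bound j'.
have b2 : j'%:R / M%:R <= j'.+1%:R / M%:R :> R.
  by rewrite ler_pM2r ?invr_gt0// ler_nat.
have vE : val (clamp (j'%:R / M%:R : R)) = j'%:R / M%:R.
  by apply: val_clamp; rewrite b0 (le_trans b2).
exists (phi e (clamp (j'%:R / M%:R))); split; apply/pieceP.
  exists (clamp (j'%:R / M%:R)); rewrite // vE.
  by rewrite /= !ler_pM2r ?invr_gt0// !ler_nat jj.
by exists (clamp (j'%:R / M%:R)); rewrite // vE lexx.
Qed.

Definition end_piece (j : 'I_M) := (j == 0 :> nat) || (j == M.-1 :> nat).

(** Besides neighbours on one arc, only end pieces are joined: this bounds the
degree by a constant which does not depend on M, without any analysis of how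
pieces of different arcs meet. *)
Definition piece_adj : rel (F * 'I_M) := fun k l =>
  (k.1 == l.1) && ((k.2 <= l.2.+1) && (l.2 <= k.2.+1))%N ||
  [&& end_piece k.2, end_piece l.2 & `[< exists x, piece k x /\ piece l x >]].

Lemma piece_adjC k l : piece_adj k l = piece_adj l k.
Proof.
rewrite /piece_adj eq_sym; congr (_ && _ || _); first exact: andbC.
rewrite andbCA; congr [&& _, _ & _]; apply/asboolP/asboolP;
by move=> [x [? ?]]; exists x.
Qed.

Lemma piece_adjxx k : piece_adj k k.
Proof. by rewrite /piece_adj eqxx/= leqnSn. Qed.

Lemma piece_adj_touch k l : piece_adj k l -> exists x, piece k x /\ piece l x.
Proof.
case: k l => [e j] [e' j'] /orP[/= /andP[/eqP-> /andP[]]|/and3P[_ _ /asboolP//]].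
exact: piece_touch.
Qed.

Lemma piece_adj_close k l x y :
  piece_adj k l -> piece k x -> piece l y -> mdist x y <= (2 * L) / M%:R.
Proof.
move=> /piece_adj_touch[z [kz lz]] kx ly.
apply: le_trans (metric_triangle _ z _) _.
by have := piece_diam kx kz; have := piece_diam lz ly; lra.
Qed.

Lemma card_piece_adj k : (#|[set l | piece_adj k l]%SET| <= 3 + 2 * #|F|)%N.
Proof.
pose S1 := finset.setX [set k.1]%SET [set j : 'I_M | (k.2 <= j.+1)%N && (j <= k.2.+1)%N]%SET.
pose S2 := finset.setX [set: F]%SET [set j : 'I_M | end_piece j]%SET.
apply: (@leq_trans #|S1 :|: S2|).
  apply/subset_leq_card/fintype.subsetP => l; rewrite !inE/= eq_sym.
  by move=> /orP[->//|/and3P[_ ->]]; rewrite orbT.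
rewrite (leq_trans (leq_card_setU _ _))// leq_add//.
  by rewrite cardsX cards1 mul1n card_near_ord.
rewrite cardsX cardsT mulnC leq_mul//.
apply: (@card_ord_le_size _ _ [:: 0%N; M.-1]) => j.
by rewrite !inE.
Qed.

Let piece_conn_sym : connect_sym piece_adj.
Proof. by apply: sym_connect_sym => k l; rewrite piece_adjC. Qed.

Lemma connect_same_arc e (j j' : 'I_M) : connect piece_adj (e, j) (e, j').
Proof.
have zero (i : 'I_M) : connect piece_adj (e, Ordinal M0) (e, i).
  case: i => i; elim: i => [|i ih] iM.
    by rewrite (_ : Ordinal iM = Ordinal M0)//; exact: val_inj.
  apply: connect_trans (ih (ltnW iM)) _; apply: connect1.
  by apply/orP; left; rewrite eqxx/=; lia.
by apply: connect_trans (zero j'); rewrite piece_conn_sym.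
Qed.

Lemma end_in_end_piece e (t : I) : arc_end t ->
  exists2 j : 'I_M, end_piece j & piece (e, j) (phi e t).
Proof.
have M1 : (M.-1 < M)%N by rewrite prednK.
move=> /orP[] /eqP tE; [exists (Ordinal M0)|exists (Ordinal M1)].
- by rewrite /end_piece eqxx.
- by apply/pieceP; exists t => //=; rewrite tE mul0r lexx divr_ge0.
- by rewrite /end_piece eqxx orbT.
- apply/pieceP; exists t => //=; rewrite tE prednK// divff ?gt_eqF// lexx andbT.
  by rewrite ler_pdivrMr// mul1r ler_nat leq_pred.
Qed.

(** Pieces of one arc form a chain, and arcs with a common end point have end
pieces that touch there. *)
Lemma piece_connected k l : connect piece_adj k l.
Proof.
case: k l => [e j] [e' j'].
have /connectP[p] := phi_link e e'.
elim: p e j => [|a p ih] e j /=.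
  by move=> _ ->; exact: connect_same_arc.
move=> /andP[/asboolP[s [t [es et st]]] ap] lE.
have [js jse jsx] := end_in_end_piece e es.
have [jt jte jtx] := end_in_end_piece a et.
apply: connect_trans (connect_same_arc e j js) _.
apply: connect_trans (ih a jt ap lE); apply: connect1.
apply/orP; right; rewrite jse jte/=; apply/asboolP.
by exists (phi e s); split=> //; rewrite st.
Qed.
End subdivision.

(** Closed pieces overlap at their end points only, so the cell made from a piece
contains the whole open piece, and its mass is at least that of a parameter
interval of length 1 / M, up to the constants w and c. *)
Lemma arcs_has_grids : has_grids mu 1.
Proof.
have [c c0 mu_lam] := density_lower_bound muf.
exists #|F|, (3 + 2 * #|F|)%N, (c * w), (2 * L); split=> //.
- exact: mulr_gt0.
- exact: mulr_ge0.
move=> M M0; have MR0 : 0 < M%:R :> R by rewrite ltr0n.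
have [kappa [kappaP mkappa kappaE]] :=
  @cells_of_cover _ (Borel T) _ (@piece M) (@measurable_piece M) (piece_cover M0).
exists (F * 'I_M)%type, kappa, (@piece_adj M); split.
- exact: mkappa.
- split.
  + exact: piece_adjC.
  + exact: piece_adjxx.
  + exact: piece_connected.
  + exact: card_piece_adj.
- by move=> y z yz; apply: (piece_adj_close M0 yz); exact: kappaP.
- move=> [e j]; rewrite expr1 -lee_fin fineK ?fin_num_measure//.
  apply: le_trans (mu_lam _ (mkappa _)).
  rewrite -mulrA EFinM lee_pmul2l ?lte_fin//.
  apply: le_trans (lam_arc e (mkappa _)).
  rewrite EFinM lee_pmul2l ?lte_fin//.
  have a0 : 0 <= j%:R / M%:R :> R by rewrite divr_ge0.
  have b1 : j.+1%:R / M%:R <= 1 :> R by rewrite ler_pdivrMr// mul1r ler_nat.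
  have ab : j%:R / M%:R <= j.+1%:R / M%:R :> R.
    by rewrite ler_pM2r ?invr_gt0// ler_nat.
  have -> : M%:R^-1 = j.+1%:R / M%:R - j%:R / M%:R :> R.
    by rewrite -mulrBl -natr1 addrC addKr mul1r.
  rewrite -(I_uniform_segment a0 ab b1); apply: le_measure; rewrite ?inE.
  + exact: measurable_I_segment.
  + have := @continuous_Borel R _ _ _ (phi_cont (e := e)) measurableT _ (mkappa (e, j)).
    by rewrite setTI.
  move=> t /= /andP[jt tj]; apply: kappaE.
    by apply/(pieceP M0); exists t => //=; rewrite !ltW.
  move=> [e' j'] /(pieceP M0)[s /= /andP[js sj] st].
  have [| ? ?] := phi_inj _ (esym st).
    by rewrite (le_lt_trans a0 jt) (lt_le_trans tj b1).
  subst e' s; congr pair.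
  by apply: (grid_index_unique M0 (x := val t)); apply/andP; split.
- by rewrite card_prod card_ord expn1.
Qed.
End arcs.

(** * The interval and the circle *)

Lemma image_lawE d d' (S : measurableType d) (T : measurableType d')
    (R : realType) (P : probability S R) (f : S -> T)
    (mf : measurable_fun [set: S] f) (A : set T) :
  image_law P mf A = P (f @^-1` A).
Proof. by []. Qed.

Section interval.
Context {R : realType}.
Local Notation I := (unit_interval R).

Lemma interval_has_grids (mu : probability (Borel I) R) :
  has_bounded_density (@I_uniform R) mu -> has_grids mu 1.
Proof.
apply: (@arcs_has_grids R I (@I_uniform R) mu unit (fun _ t => t) 1 1) => //.
- by move=> e s t; rewrite mul1r.
- by move=> x; exists tt, x.
- by move=> [] s [] t _.
- by move=> [] []; exact: connect0.
- by move=> e A mA; rewrite mul1e.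
Qed.
End interval.

Section circle.
Context {R : realType}.
Local Notation I := (unit_interval R).

Lemma circle_of_I_lip (s t : I) :
  mdist (circle_of_I s) (circle_of_I t) <= 2 * mdist s t.
Proof.
apply: le_trans (C_dist_le (arcs_pt _ _)) _.
rewrite -mulrBr normrM ger0_norm ?mulr_ge0 ?pi_ge0//.
by rewrite mulrAC mulfK// gt_eqF// pi_gt0.
Qed.

Lemma cos_eq1 (x : R) : 0 <= x < 2 * pi -> cos x = 1 -> x = 0.
Proof.
move=> /andP[x0 x2] cx; apply: contrapT => /eqP xN0.
have {x0 xN0} x0 : 0 < x by rewrite lt_def xN0.
have s0 : 0 < sin (x / 2) by apply: sin_gt0_pi; apply/andP; split; lra.
have := cosD (x / 2) (x / 2); rewrite -splitr cx.
by have := cos2Dsin2 (x / 2); nra.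
Qed.

(** The hypothesis is strict on s because the two ends of the interval have the
same image. *)
Lemma circle_of_I_inj (s t : I) :
  0 < val s < 1 -> circle_of_I s = circle_of_I t -> s = t.
Proof.
move=> s01 st; have t01 : 0 <= val t <= 1 := valP t.
have pi0 : 0 < pi :> R := pi_gt0 R.
have [cE sE] : cos (2 * pi * val s) = cos (2 * pi * val t) /\
    sin (2 * pi * val s) = sin (2 * pi * val t).
  by have := congr1 val st => -[].
have c1 : cos (2 * pi * (val s - val t)) = 1.
  by rewrite mulrBr cosB cE sE -!expr2 cos2Dsin2.
have {c1} : cos (2 * pi * `|val s - val t|) = 1.
  by case: (ger0P (val s - val t)) => // _; rewrite mulrN cosN.
move=> /cos_eq1 h; apply/val_inj/eqP; rewrite -subr_eq0 -normr_eq0.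
have : 2 * pi * `|val s - val t| = 0.
  apply: h; apply/andP; split; first by rewrite !mulr_ge0 ?pi_ge0.
  rewrite -[ltRHS]mulr1 ltr_pM2l ?mulr_gt0// ltr_norml.
  by apply/andP; split; lra.
by move=> /eqP; rewrite mulf_eq0 gt_eqF ?mulr_gt0.
Qed.

Lemma circle_has_grids (mu : probability (Borel (circle R)) R) :
  has_bounded_density (@circle_uniform R) mu -> has_grids mu 1.
Proof.
apply: (@arcs_has_grids R (circle R) (@circle_uniform R) mu unit
  (fun _ => circle_of_I) 2 1) => //.
- by move=> _ s t; exact: circle_of_I_lip.
- move=> p; have [t t01 ->] := circle_ptP p; exists tt, (clamp t).
  by rewrite /circle_of_I val_clamp.
- by move=> [] s [] t s01 /(circle_of_I_inj s01).
- by move=> [] []; exact: connect0.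
- by move=> e A mA; rewrite mul1e /circle_uniform image_lawE.
Qed.
End circle.

(** * Embedded graphs *)

Section graph.
Context {R : realType} (G : embedded_graph R).
Local Notation I := (unit_interval R).
Local Notation X := (graph_space G).

Lemma edge_point_lip (uv : oriented_edge G) (s t : I) :
  mdist (edge_point uv s) (edge_point uv t) <= #|edges G|%:R^-1 * mdist s t.
Proof.
case: uv => -[u v] uv.
apply: le_trans (graph_dist_le (@path_one _ _ _ _ u v _ _)) _; try exact: edge_coord_on.
rewrite mulrC ler_wpM2l ?invr_ge0//.
have nuv : u != v by apply: contraTneq uv => /= ->; rewrite adj_irr.
rewrite /bary/= !ffunE eqxx (negPf nuv) !addr0 !mulr1n.
have -> : 1 - val s - (1 - val t) = - (val s - val t) by lra.
by rewrite normrN.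
Qed.

(** Orienting each edge by the enumeration of the vertices selects one of the two
parametrisations that it has. *)
Definition edge_chart := {uv : oriented_edge G |
  (enum_rank (val uv).1 < enum_rank (val uv).2)%N}.

Let phi (e : edge_chart) : I -> X := edge_point (val e).

Let src (e : edge_chart) : G := (val (val e)).1.
Let dst (e : edge_chart) : G := (val (val e)).2.

Lemma edge_chart_exists u v : adj u v ->
  exists e, (src e, dst e) = (u, v) \/ (src e, dst e) = (v, u).
Proof.
move=> uv.
have [r|r|/val_inj/enum_rank_inj uE] := ltngtP (enum_rank u) (enum_rank v).
- by exists (exist _ (exist _ (u, v) uv) r); left.
- have vu : adj v u by rewrite adj_sym.
  by exists (exist _ (exist _ (v, u) vu) r); right.
- by rewrite uE adj_irr in uv.
Qed.

Let bary_phi e t w : bary (phi e t) w = (1 - val t) *+ (w == src e) + val t *+ (w == dst e).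
Proof. by rewrite /bary/= ffunE. Qed.

Let src_dst e : src e != dst e.
Proof. by apply: contraTneq (valP (val e)) => /= h; rewrite -/(src e) h adj_irr. Qed.

Let phi_cover x : exists e t, phi e t = x.
Proof.
have [u [v xuv]] := bary_edge x.
have uv : adj u v by case/andP: xuv.
have [e euv] := edge_chart_exists uv.
have xe : on_edge (bary x) (src e) (dst e).
  by case: euv => -[-> ->] //; exact: on_edgeC.
case: e {euv} xe => -[[a b] ab] abr xe; have [t ->] := edge_pointP xe ab.
by exists (exist _ (exist _ (a, b) ab) abr), t.
Qed.

Let phi_inj e (s : I) e' (t : I) : 0 < val s < 1 -> phi e s = phi e' t -> e = e' /\ s = t.
Proof.
move=> s01 st.
have st_w w : bary (phi e s) w = bary (phi e' t) w by rewrite st.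
have := st_w (src e); have := st_w (dst e); rewrite !bary_phi !eqxx.
rewrite [dst e == src e]eq_sym (negPf (src_dst e)) !mulr1n !mulr0n addr0 add0r => dE sE.
have se : (src e == src e') || (src e == dst e').
  by move: sE; case: eqP => //; case: eqP => // _ _; rewrite !mulr0n; lra.
have de : (dst e == src e') || (dst e == dst e').
  by move: dE; case: eqP => //; case: eqP => // _ _; rewrite !mulr0n; lra.
have nd := src_dst e; have nd' := src_dst e'.
have r := valP e; have r' := valP e'; rewrite /= -/(src e) -/(dst e) in r.
rewrite /= -/(src e') -/(dst e') in r'.
have [ee de'] : src e = src e' /\ dst e = dst e'.
  case/orP: se => /eqP se; case/orP: de => /eqP de.
  - by rewrite se de eqxx in nd.
  - by [].
  - by move: r; rewrite se de ltnNge (ltnW r').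
  - by rewrite se de eqxx in nd.
split; last first.
  apply: val_inj; move: dE.
  by rewrite de' eqxx eq_sym (negPf nd') mulr0n add0r mulr1n.
by do 2 apply: val_inj; rewrite (surjective_pairing (val (val e)))
  (surjective_pairing (val (val e'))); congr pair.
Qed.

Let incident (e : edge_chart) (a : G) := (a == src e) || (a == dst e).

Let incident_end e a : incident e a -> exists2 t, arc_end t & phi e t = vertex_point a.
Proof.
have v0 : val (clamp 0 : I) = 0 by apply: val_clamp; rewrite lexx ler01.
have v1 : val (clamp 1 : I) = 1 by apply: val_clamp; rewrite lexx ler01.
move=> /orP[] /eqP->; [exists (clamp 0)|exists (clamp 1)];
  rewrite /arc_end ?v0 ?v1 ?eqxx ?orbT//;
  apply/bary_inj/ffunP => w; rewrite bary_phi [RHS]ffunE ?v0 ?v1.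
- by rewrite mul0rn addr0 subr0.
- by rewrite subrr mul0rn add0r.
Qed.

Let incident_linked e e' a : incident e a -> incident e' a -> linked_arcs phi e e'.
Proof.
move=> /incident_end[s es sa] /incident_end[t et ta]; apply/asboolP.
by exists s, t; split; rewrite // sa ta.
Qed.

Let phi_link e e' : connect (linked_arcs phi) e e'.
Proof.
have gen p a f : incident f a -> path (@adj R G) a p -> src e' = last a p ->
    connect (linked_arcs phi) f e'.
  elim: p a f => [|b p ih] a f fa /=.
    move=> _ E; apply: connect1; apply: (incident_linked fa).
    by rewrite /incident -E eqxx.
  move=> /andP[ab bp] lE; have [g gab] := edge_chart_exists ab.
  have [ga gb] : incident g a /\ incident g b.
    by rewrite /incident; case: gab => -[-> ->]; rewrite !eqxx ?orbT.
  apply: connect_trans (ih b g gb bp lE); apply: connect1.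
  exact: incident_linked fa ga.
have /connectP[p ap pE] := adj_connected (src e) (src e').
by apply: gen ap pE; rewrite /incident eqxx.
Qed.

(** Charts of edges are arcs, linked at common vertices; dropping one of the
two orientations of each edge costs a factor 2 in the mass, and only a lower bound
of the mass is needed. *)
Lemma graph_has_grids (mu : probability (Borel X) R) :
  has_bounded_density (graph_uniform G) mu -> has_grids mu 1.
Proof.
have E0 : 0 < #|edges G|%:R :> R by rewrite ltr0n edges_gt0.
have O0 : 0 < #|{: oriented_edge G}|%:R :> R by rewrite ltr0n oriented_edge_gt0.
apply: (@arcs_has_grids R X (graph_uniform G) mu edge_chart phi
  #|edges G|%:R^-1 #|{: oriented_edge G}|%:R^-1) => //.
- by move=> e s t; exact: edge_point_lip.
- by rewrite invr_gt0.
move=> e A mA; apply: lee_wpmul2l.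
  by rewrite lee_fin invr_ge0.
by rewrite (bigD1 (val e))//= leeDl// sume_ge0.
Qed.
End graph.

(** * Cubes *)

Section tuple_box.
Context d (T : measurableType d) (R : realType) (P : probability T R).

Lemma measurable_tuple_box n (B : 'I_n -> set T) : (forall i, measurable (B i)) ->
  measurable [set t : n.-tuple T | forall i, B i (tnth t i)].
Proof.
move=> mB; rewrite (_ : [set _ | _] =
    \bigcap_(i in [set: 'I_n]) ((fun t : n.-tuple T => tnth t i) @^-1` B i)).
  apply: fin_bigcap_measurable => // i _; rewrite -[X in measurable X]setTI.
  by apply: measurable_tnth.
by apply/seteqP; split=> [t tB i _|t tB i]; exact: tB.
Qed.

Lemma tuple_law_box n (B : 'I_n -> set T) : (forall i, measurable (B i)) ->
  tuple_law P n [set t | forall i, B i (tnth t i)] = (\prod_(i < n) P (B i))%E.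
Proof.
elim: n B => [|n ih] B mB.
  have tB : [set t : 0.-tuple T | forall i, B i (tnth t i)] [tuple] by case.
  by rewrite big_ord0 /= diracE (mem_set tB).
rewrite big_ord_recl -(ih (fun i => B (lift ord0 i)))//.
have mBS := measurable_tuple_box (fun i => mB (lift ord0 i)).
rewrite -product_measure1E// image_lawE; congr (_ _); apply/seteqP; split=> -[x t] /=.
  move=> tB; split=> [|i]; first by have := tB ord0; rewrite tnth0.
  by have := tB (lift ord0 i); rewrite tnthS.
move=> [Bx Bt] i; have [j ->|->] := unliftP ord0 i.
  by rewrite tnthS.
by rewrite tnth0.
Qed.
End tuple_box.

Section cube.
Context {R : realType} (D : nat).
Local Notation Q := (cube R D).

Let coord (i : 'I_D) (x : Q) : R := val x 0 i.

Lemma coord_dist i (x y : Q) : `|coord i x - coord i y| <= mdist x y.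
Proof. exact: (le_bigmax _ (fun i => `|val x 0 i - val y 0 i|)). Qed.

Lemma continuous_coord i : continuous (coord i).
Proof.
move=> x; apply/(@cvgrPdist_lt _ R _ _ (nbhs_filter x)) => e e0.
apply: filterS (nbhsx_ballx x e e0) => y; rewrite ballEmdist.
exact: le_lt_trans (coord_dist _ _ _).
Qed.

Lemma coord01 i x : 0 <= coord i x <= 1.
Proof. by have /forallP := valP x; apply. Qed.

Section subdivision.
Variable M : nat.
Hypothesis M0 : (0 < M)%N.
Let MR0 : 0 < M%:R :> R. Proof. by rewrite ltr0n. Qed.
Local Notation K := {ffun 'I_D -> 'I_M}.

Definition box (k : K) : set Q :=
  [set x | forall i, (k i)%:R / M%:R <= coord i x <= (k i).+1%:R / M%:R].

Lemma measurable_box k : measurable (box k : set (Borel Q)).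
Proof.
rewrite (_ : box k = \bigcap_(i in [set: 'I_D]) (coord i @^-1`
    `[(k i)%:R / M%:R, (k i).+1%:R / M%:R]%classic)).
  apply: fin_bigcap_measurable => // i _.
  rewrite -[X in measurable X]setCK; apply: measurableC; apply: sub_sigma_algebra.
  rewrite openC; move/continuous_closedP : (@continuous_coord i); apply.
  exact: interval_closed.
apply/seteqP; split=> [x xk i _|x xk i].
  by rewrite /= in_itv; exact: xk.
by have := xk i I; rewrite /= in_itv.
Qed.

Lemma box_cover x : exists k, box k x.
Proof.
have /choice[k kx] i := grid_index_exists M0 (coord01 i x).
by exists [ffun i => k i] => i; rewrite ffunE.
Qed.

(** King moves, rather than steps along one coordinate: in the sup metric they
go no further, and connectedness and the degree bound come from one coordinate at
a time. *)
Definition box_adj : rel K :=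
  fun k l => [forall i, (k i <= (l i).+1)%N && (l i <= (k i).+1)%N].

Lemma box_adjC k l : box_adj k l = box_adj l k.
Proof. by apply: eq_forallb => i; rewrite andbC. Qed.

Lemma box_adjxx k : box_adj k k.
Proof. by apply/forallP => i; rewrite leqnSn. Qed.

Lemma box_adj_close k l y z :
  box_adj k l -> box k y -> box l z -> mdist y z <= 2 / M%:R.
Proof.
move=> /forallP kl ky lz; apply/bigmax_leP; split=> [|i _]; first by rewrite divr_ge0.
have := ky i; have := lz i; have /andP[k_l l_k] := kl i.
rewrite -(ler_nat R) in k_l; rewrite -(ler_nat R) in l_k; move: k_l l_k.
rewrite -/(coord i y) -/(coord i z) !ler_pdivrMr// !ler_pdivlMr// -!natr1 => k_l l_k zl yk.
rewrite -(ger0_norm (ltW MR0)) -normrM mulrBl ler_norml; lra.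
Qed.

Lemma card_box_adj k : (#|[set l | box_adj k l]%SET| <= 3 ^ D)%N.
Proof.
pose near i := [set j : 'I_M | (k i <= j.+1)%N && (j <= (k i).+1)%N]%SET.
apply: (@leq_trans #|family near|).
  apply/subset_leq_card/fintype.subsetP => l; rewrite inE => /forallP kl.
  by apply/familyP => i; rewrite inE.
rewrite card_family foldrE big_map big_enum/=.
rewrite -[X in (_ <= _ ^ X)%N]card_ord -prod_nat_const.
by apply: leq_prod => i _; exact: card_near_ord.
Qed.

Let dec (k : K) : K :=
  [ffun i => Ordinal (leq_ltn_trans (leq_pred (k i)) (ltn_ord (k i)))].

Let iter_dec m k i : iter m dec k i = (k i - m)%N :> nat.
Proof. by elim: m => [|m ih]/=; rewrite ?subn0// ffunE/= ih subnS. Qed.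

Let connect_iter_dec m k : connect box_adj k (iter m dec k).
Proof.
elim: m => [|m ih]; first exact: connect0.
apply: connect_trans ih _; apply: connect1; apply/forallP => i.
by rewrite /= ffunE/=; lia.
Qed.

(** Decreasing all the coordinates at once, down to 0, is a path of king moves;
two boxes are connected through the box at the origin. *)
Lemma box_connected k l : connect box_adj k l.
Proof.
have -> : connect box_adj k l = connect box_adj k (iter M dec l).
  apply: (same_connect_r (sym_connect_sym box_adjC)).
  exact: connect_iter_dec.
rewrite (_ : iter M dec l = iter M dec k); first exact: connect_iter_dec.
have z (j : 'I_M) : (j - M)%N = 0%N by apply/eqP; rewrite subn_eq0 ltnW.
by apply/ffunP => i; apply/val_inj; rewrite /= !iter_dec !z.
Qed.

Lemma cube_uniform_open_box (k : K) :
  cube_uniform R D [set x | forall i, (k i)%:R / M%:R < coord i x < (k i).+1%:R / M%:R]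
  = (M%:R ^- D)%:E.
Proof.
pose B i := [set s : unit_interval R |
  (k i)%:R / M%:R < val s < (k i).+1%:R / M%:R].
rewrite /cube_uniform image_lawE.
rewrite (_ : _ @^-1` _ = [set t : D.-tuple (Borel (unit_interval R)) |
    forall i, B i (tnth t i)]); last first.
  by apply/seteqP; split=> t tk i; have := tk i; rewrite /coord mxE.
rewrite (@tuple_law_box _ (Borel (unit_interval R)) _ _ _ B) => [|i]; last first.
  exact: measurable_I_segment.
rewrite (eq_bigr (fun=> (M%:R^-1)%:E)) => [|i _].
  by rewrite prodEFin prodr_const card_ord exprVn.
rewrite I_uniform_segment.
- by rewrite -mulrBl -natr1 addrC addKr mul1r.
- by rewrite divr_ge0.
- by rewrite ler_pM2r ?invr_gt0// ler_nat.
- by rewrite ler_pdivrMr// mul1r ler_nat.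
Qed.
End subdivision.

Lemma cube_has_grids (mu : probability (Borel Q) R) :
  has_bounded_density (cube_uniform R D) mu -> has_grids mu D.
Proof.
move=> muf; have [c c0 mu_lam] := density_lower_bound muf.
exists 1%N, (3 ^ D)%N, c, 2; split=> //; first by rewrite expn_gt0.
move=> M M0; have MR0 : 0 < M%:R :> R by rewrite ltr0n.
have [kappa [kappaP mkappa kappaE]] :=
  @cells_of_cover _ (Borel Q) _ (@box M) (@measurable_box M) (box_cover M0).
exists {ffun 'I_D -> 'I_M}, kappa, (@box_adj M); split.
- exact: mkappa.
- split.
  + exact: box_adjC.
  + exact: box_adjxx.
  + exact: box_connected.
  + exact: card_box_adj.
- by move=> y z yz; apply: (box_adj_close M0 yz); exact: kappaP.
- move=> k; rewrite -lee_fin fineK ?fin_num_measure//.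
  apply: le_trans (mu_lam _ (mkappa _)).
  rewrite EFinM lee_pmul2l ?lte_fin// -(cube_uniform_open_box M0 k).
  apply: le_measure; rewrite ?inE.
  + rewrite (_ : [set x | _] = \bigcap_(i in [set: 'I_D]) (coord i @^-1`
        `](k i)%:R / M%:R, (k i).+1%:R / M%:R[%classic)).
      apply: fin_bigcap_measurable => // i _; apply: sub_sigma_algebra.
      move/continuousP : (@continuous_coord i); apply; exact: interval_open.
    apply/seteqP; split=> [x xk i _|x xk i].
      by rewrite /= in_itv; exact: xk.
    by have := xk i I; rewrite /= in_itv.
  + exact: mkappa.
  move=> x xk; apply: kappaE.
    by move=> i; have /andP[kx xk'] := xk i; rewrite !ltW.
  move=> l lx; apply/ffunP => i; exact: grid_index_unique (xk i) (lx i).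
- by rewrite card_ffun !card_ord mul1n.
Qed.
End cube.

(** * Asymptotic disintegrability of intervals, circles, graphs and cubes *)

Theorem theorem1p3 (R : realType) (alpha : R) (alpha_gt0 : 0 < alpha) :
  [/\ forall mu : probability (Borel (unit_interval R)) R,
        has_bounded_density (@I_uniform R) mu ->
        asymptotically_disintegrable_O mu
          (fun n => n%:R `^ (- alpha)) (fun n => Num.sqrt (ln n%:R / n%:R)),
      forall mu : probability (Borel (circle R)) R,
        has_bounded_density (@circle_uniform R) mu ->
        asymptotically_disintegrable_O mu
          (fun n => n%:R `^ (- alpha)) (fun n => Num.sqrt (ln n%:R / n%:R)),
      forall (G : embedded_graph R) (mu : probability (Borel (graph_space G)) R),
        has_bounded_density (graph_uniform G) mu ->
        asymptotically_disintegrable_O mu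
          (fun n => n%:R `^ (- alpha)) (fun n => Num.sqrt (ln n%:R / n%:R))
    & forall (D : nat), (2 <= D)%N ->
        forall mu : probability (Borel (cube R D)) R,
        has_bounded_density (cube_uniform R D) mu ->
        asymptotically_disintegrable_O mu
          (fun n => n%:R `^ (- alpha))
          (fun n => (ln n%:R / n%:R) `^ (1 / (2 * D%:R)))].
Proof.
have sqrtE : (fun n => Num.sqrt (ln n%:R / n%:R)) =
    (fun n => (ln n%:R / n%:R) `^ (1 / (2 * 1%:R))) :> (nat -> R).
  apply/funext => n; rewrite -powR12_sqrt ?rate_base_ge0//.
  by rewrite mulr1 div1r.
split; rewrite ?sqrtE.
- by move=> mu /interval_has_grids; exact: grids_rate.
- by move=> mu /circle_has_grids; exact: grids_rate.
- by move=> G mu /graph_has_grids; exact: grids_rate.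
- move=> D D2 mu /cube_has_grids; apply: grids_rate => //.
  exact: leq_trans D2.
Qed.
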